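(* For integers $m,n\ge 1$, the master polynomial satisfies $$\widetilde{Z}_{m,n}(u,t,z)=u^{mn}z^{-mn^2}\,\widetilde{Z}_{m,n}(u^{-1}z^{2n},\,u^{-1}tz^n,\,z).$$ In particular, for a prime power $q$ and each of the rings $R=R_{2,2m+1}$, $R_{2,2m}$, $R'_{2,2m}$, with $\delta_R:=\dim_{\mathbb{F}_q}\widetilde{R}/R$, $$Z_{R,n}(u,t,q)=u^{\delta_R n}q^{\delta_R n^2}\,Z_{R,n}(u^{-1}q^{-2n},\,u^{-1}tq^{-n},\,q).$$
   Context: Pochhammer symbols: $(A;z)_N:=\prod_{j=0}^{N-1}(1-Az^j)$, with $1/(z;z)_k:=0$ for $k<0$. The master polynomial in $\mathbb{Z}[u,t,z^{-1}]$ is $$\widetilde{Z}_{m,n}(u,t,z):=\sum_{n_1,\ldots,n_m\ge 0}\frac{u^{mn-\sum_{i=1}^m n_i}\,z^{-mn^2+\sum_{i=1}^m n_i^2}\,(z;z)_n\,(u^{-1}tz;z)_n}{(z;z)_{n-n_m}(z;z)_{n_m-n_{m-1}}\cdots(z;z)_{n_2-n_1}(z;z)_{n_1}(u^{-1}tz;z)_{n_1}},$$ where $u,t,z$ are indeterminates (the substitution in the claim takes place in Laurent polynomials). The rings are $R_{2,2m+1}=\mathbb{F}_q[[T^2,T^{2m+1}]]\subseteq\mathbb{F}_q[[T]]$, $R_{2,2m}=\mathbb{F}_q[[X,Y]]/(Y(Y-X^m))$, and $R'_{2,2m}=\mathbb{F}_q[[T]]+T^m\mathbb{F}_{q^2}[[T]]\subseteq\mathbb{F}_{q^2}[[T]]$.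 $\widetilde{R}$ denotes the normalization (integral closure of $R$ in its total ring of fractions). Define $$Z_{R,n}(u,t,q):=\widetilde{Z}_{m,n}(u,\epsilon_R t,q^{-1}),\qquad \epsilon_R:=\begin{cases}0,&R=R_{2,2m+1},\\ 1,&R=R_{2,2m},\\ -1,&R=R'_{2,2m}.\end{cases}$$ *)

(* Defs.v *)
From HB Require Import structures.
From mathcomp Require Import all_boot all_order all_algebra fieldext.
From mathcomp Require Import boolp classical_sets.
From mathcomp Require Import ring zify.

Set Implicit Arguments.
Unset Strict Implicit.
Unset Printing Implicit Defensive.

Import GRing.Theory.
Local Open Scope ring_scope.
Local Open Scope quotient_scope.

Record fps (R : Type) := FPS { fps_coef : nat -> R }.

Lemma fpsP (R : Type) (f g : fps R) : fps_coef f =1 fps_coef g <-> f = g.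
Proof.
split=> [|-> //]; case: f g => [f] [g] /= /funext; by move->.
Qed.

HB.instance Definition _ (R : Type) := gen_eqMixin (fps R).
HB.instance Definition _ (R : Type) := gen_choiceMixin (fps R).

Section FpsRing.
Variable R : comNzRingType.
Implicit Types f g h : fps R.
Local Notation "f `# i" := (fps_coef f i) (at level 2).

Definition fps_add f g := FPS (fun k => f`#k + g`#k).
Definition fps_opp f := FPS (fun k => - f`#k).
Definition fpsC (a : R) := FPS (fun k => if k == 0%N then a else 0).
Definition fps_mul f g := FPS (fun k => \sum_(i < k.+1) f`#i * g`#(k - i)).

Let trunc N f : {poly R} := \poly_(i < N.+1) f`#i.

Let coef_trunc N f i : (i <= N)%N -> (trunc N f)`_i = f`#i.
Proof. by move=> iN; rewrite coef_poly ltnS iN. Qed.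

Let truncM N f g i : (i <= N)%N ->
  (fps_mul f g)`#i = (trunc N f * trunc N g)`_i.
Proof.
move=> iN; rewrite coefM /=; apply: eq_bigr => j _.
rewrite !coef_trunc //; first by rewrite (leq_trans _ iN) // leq_subr.
by rewrite (leq_trans _ iN) // -ltnS.
Qed.

Let coefM_eq (p p' r r' : {poly R}) N :
  (forall i, (i <= N)%N -> p`_i = p'`_i) ->
  (forall i, (i <= N)%N -> r`_i = r'`_i) -> (p * r)`_N = (p' * r')`_N.
Proof.
move=> ep er; rewrite !coefM; apply: eq_bigr => j _.
by rewrite ep ?er ?leq_subr // -ltnS.
Qed.

Fact fps_addA : associative fps_add.
Proof. by move=> f g h; apply/fpsP => k /=; rewrite addrA. Qed.
Fact fps_addC : commutative fps_add.
Proof. by move=> f g; apply/fpsP => k /=; rewrite addrC. Qed.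
Fact fps_add0 : left_id (fpsC 0) fps_add.
Proof. by move=> f; apply/fpsP => k /=; rewrite if_same add0r. Qed.
Fact fps_addN : left_inverse (fpsC 0) fps_opp fps_add.
Proof. by move=> f; apply/fpsP => k /=; rewrite if_same addNr. Qed.

HB.instance Definition _ :=
  GRing.isZmodule.Build (fps R) fps_addA fps_addC fps_add0 fps_addN.

Fact fps_mulC : commutative fps_mul.
Proof.
by move=> f g; apply/fpsP => k; rewrite !(@truncM k) // mulrC.
Qed.
Fact fps_mulA : associative fps_mul.
Proof.
move=> f g h; apply/fpsP => k; rewrite !(@truncM k) //.
transitivity ((trunc k f * (trunc k g * trunc k h))`_k).
  by apply: coefM_eq => // i ik; rewrite coef_trunc // (truncM _ _ ik).
rewrite mulrA; apply: coefM_eq => // i ik.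
by rewrite coef_trunc // (truncM _ _ ik).
Qed.
Fact fps_mul1 : left_id (fpsC 1) fps_mul.
Proof.
move=> f; apply/fpsP => k /=; rewrite big_ord_recl /= mul1r subn0.
by rewrite big1 ?addr0 // => i _; rewrite mul0r.
Qed.
Fact fps_mulDl : left_distributive fps_mul fps_add.
Proof.
move=> f g h; apply/fpsP => k /=; rewrite -big_split /=.
by apply: eq_bigr => i _; rewrite mulrDl.
Qed.
Fact fps_oner_neq0 : fpsC 1 != 0 :> fps R.
Proof. by apply/eqP => /fpsP/(_ 0%N)/= /eqP; rewrite oner_eq0. Qed.

HB.instance Definition _ := GRing.Zmodule_isComNzRing.Build (fps R)
  fps_mulA fps_mulC fps_mul1 fps_mulDl fps_oner_neq0.

Definition fpsX : fps R := FPS (fun k => if k == 1%N then 1 else 0).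

Fact fpsC_zmod : zmod_morphism fpsC.
Proof. by move=> a b; apply/fpsP => -[|k] //=; rewrite subr0. Qed.
Fact fpsC_monoid : monoid_morphism fpsC.
Proof.
split=> // a b; apply/fpsP => k /=; rewrite big_ord_recl /= subn0.
rewrite big1 ?addr0; last by move=> i _; rewrite mul0r.
by case: k => //=; rewrite mulr0.
Qed.
HB.instance Definition _ := GRing.isZmodMorphism.Build R (fps R) fpsC fpsC_zmod.
HB.instance Definition _ :=
  GRing.isMonoidMorphism.Build R (fps R) fpsC fpsC_monoid.

End FpsRing.

Definition fps_map (R S : Type) (phi : R -> S) (f : fps R) : fps S :=
  FPS (fun k => phi (fps_coef f k)).

Section FpsMap.
Variables (R S : comNzRingType) (phi : {rmorphism R -> S}).

Fact fps_map_zmod : zmod_morphism (fps_map phi).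
Proof. by move=> f g; apply/fpsP => k /=; rewrite rmorphB. Qed.
Fact fps_map_monoid : monoid_morphism (fps_map phi).
Proof.
split; first by apply/fpsP => -[|k] /=; rewrite ?rmorph1 ?rmorph0.
move=> f g; apply/fpsP => k /=; rewrite rmorph_sum.
by apply: eq_bigr => i _; rewrite rmorphM.
Qed.
HB.instance Definition _ :=
  GRing.isZmodMorphism.Build (fps R) (fps S) (fps_map phi) fps_map_zmod.
HB.instance Definition _ :=
  GRing.isMonoidMorphism.Build (fps R) (fps S) (fps_map phi) fps_map_monoid.

End FpsMap.

(* Pairs (a, s) with s a non-zero-divisor, modulo (a, s) ~ (b, r) iff
   a r = b s. *)
Section TotalFractions.
Variable R : comNzRingType.

Definition nonzerodiv : pred R := fun s => `[< GRing.lreg s >].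

Lemma nonzerodivP s : reflect (GRing.lreg s) (nonzerodiv s).
Proof. exact: asboolP. Qed.

Lemma nonzerodiv1 : nonzerodiv 1.
Proof. by apply/nonzerodivP; apply: lreg1. Qed.

Lemma nonzerodivM s r : nonzerodiv s -> nonzerodiv r -> nonzerodiv (s * r).
Proof. by move=> /nonzerodivP hs /nonzerodivP hr; apply/nonzerodivP/lregM. Qed.

Record tratio := TRatio { tnum : R; tden : R; tdenP : nonzerodiv tden }.

HB.instance Definition _ := gen_eqMixin tratio.
HB.instance Definition _ := gen_choiceMixin tratio.

Definition tequiv (x y : tratio) := tnum x * tden y == tnum y * tden x.

Fact tequiv_refl : reflexive tequiv.
Proof. by move=> x; rewrite /tequiv. Qed.
Fact tequiv_sym : symmetric tequiv.
Proof. by move=> x y; rewrite /tequiv eq_sym. Qed.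
Fact tequiv_trans : transitive tequiv.
Proof.
move=> [y b hb] [x a ha] [z c hc]; rewrite /tequiv /= => /eqP xy /eqP yz.
apply/eqP; move/nonzerodivP: hb; apply.
have -> : b * (x * c) = (x * b) * c by ring.
have -> : b * (z * a) = (z * b) * a by ring.
by rewrite xy -yz; ring.
Qed.

Canonical tequiv_equiv := EquivRel tequiv tequiv_refl tequiv_sym tequiv_trans.

Definition tfrac := {eq_quot tequiv}.
HB.instance Definition _ : EqQuotient _ tequiv tfrac := EqQuotient.on tfrac.
HB.instance Definition _ := Choice.on tfrac.

Definition tfrac_of (a : R) : tfrac := \pi_tfrac (TRatio a nonzerodiv1).

Definition tratio_add x y :=
  TRatio (tnum x * tden y + tnum y * tden x) (nonzerodivM (tdenP x) (tdenP y)).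
Definition tratio_opp x := TRatio (- tnum x) (tdenP x).
Definition tratio_mul x y :=
  TRatio (tnum x * tnum y) (nonzerodivM (tdenP x) (tdenP y)).

Definition tfrac_add (x y : tfrac) := \pi_tfrac (tratio_add (repr x) (repr y)).
Definition tfrac_opp (x : tfrac) := \pi_tfrac (tratio_opp (repr x)).
Definition tfrac_mul (x y : tfrac) := \pi_tfrac (tratio_mul (repr x) (repr y)).

Let reprE (x : tratio) :
  tnum (repr (\pi_tfrac x)) * tden x = tnum x * tden (repr (\pi_tfrac x)).
Proof.
apply/eqP; rewrite -[_ == _]/(tequiv (repr (\pi_tfrac x)) x).
by rewrite -eqmodE reprK.
Qed.

Let piP (x y : tratio) : tnum x * tden y = tnum y * tden x ->
  \pi_tfrac x = \pi_tfrac y.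
Proof. by move=> xy; apply/eqmodP; apply/eqP. Qed.


Lemma tfrac_addE x y :
  tfrac_add (\pi_tfrac x) (\pi_tfrac y) = \pi_tfrac (tratio_add x y).
Proof.
apply: piP => /=; case: (repr (\pi_tfrac x)) (reprE x) => a b _ /= ea.
case: (repr (\pi_tfrac y)) (reprE y) => c d _ /= ec.
transitivity ((a * tden x) * (d * tden y) + (c * tden y) * (b * tden x)).
  by ring.
by rewrite ea ec; ring.
Qed.

Lemma tfrac_oppE x : tfrac_opp (\pi_tfrac x) = \pi_tfrac (tratio_opp x).
Proof. by apply: piP => /=; rewrite !mulNr reprE. Qed.

Lemma tfrac_mulE x y :
  tfrac_mul (\pi_tfrac x) (\pi_tfrac y) = \pi_tfrac (tratio_mul x y).
Proof. by apply: piP => /=; rewrite mulrACA !reprE mulrACA. Qed.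


Fact tfrac_addA : associative tfrac_add.
Proof.
elim/quotW=> x; elim/quotW=> y; elim/quotW=> z.
by rewrite (tfrac_addE y) (tfrac_addE x y) !tfrac_addE; apply: piP => /=; ring.
Qed.
Fact tfrac_addC : commutative tfrac_add.
Proof.
by elim/quotW=> x; elim/quotW=> y; rewrite !tfrac_addE; apply: piP => /=; ring.
Qed.
Fact tfrac_add0 : left_id (tfrac_of 0) tfrac_add.
Proof. by elim/quotW=> x; rewrite tfrac_addE; apply: piP => /=; ring. Qed.
Fact tfrac_addN : left_inverse (tfrac_of 0) tfrac_opp tfrac_add.
Proof. by elim/quotW=> x; rewrite tfrac_oppE tfrac_addE; apply: piP => /=; ring. Qed.

HB.instance Definition _ :=
  GRing.isZmodule.Build tfrac tfrac_addA tfrac_addC tfrac_add0 tfrac_addN.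

Fact tfrac_mulA : associative tfrac_mul.
Proof.
elim/quotW=> x; elim/quotW=> y; elim/quotW=> z.
by rewrite (tfrac_mulE y) (tfrac_mulE x y) !tfrac_mulE; apply: piP => /=; ring.
Qed.
Fact tfrac_mulC : commutative tfrac_mul.
Proof.
by elim/quotW=> x; elim/quotW=> y; rewrite !tfrac_mulE; apply: piP => /=; ring.
Qed.
Fact tfrac_mul1 : left_id (tfrac_of 1) tfrac_mul.
Proof. by elim/quotW=> x; rewrite tfrac_mulE; apply: piP => /=; ring. Qed.
Fact tfrac_mulDl : left_distributive tfrac_mul tfrac_add.
Proof.
elim/quotW=> x; elim/quotW=> y; elim/quotW=> z.
by rewrite (tfrac_addE x) !tfrac_mulE tfrac_addE; apply: piP => /=; ring.
Qed.
Lemma tfrac_of_inj : injective tfrac_of.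
Proof.
by move=> a b /eqP; rewrite eqmodE => /eqP /=; rewrite !mulr1.
Qed.
Fact tfrac_oner_neq0 : tfrac_of 1 != tfrac_of 0.
Proof. by apply/eqP => /tfrac_of_inj /eqP; rewrite oner_eq0. Qed.

HB.instance Definition _ := GRing.Zmodule_isComNzRing.Build tfrac
  tfrac_mulA tfrac_mulC tfrac_mul1 tfrac_mulDl tfrac_oner_neq0.

Fact tfrac_of_zmod : zmod_morphism tfrac_of.
Proof.
move=> a b; rewrite -[RHS]/(tfrac_add _ (tfrac_opp _)) tfrac_oppE tfrac_addE.
by apply: piP => /=; ring.
Qed.
Fact tfrac_of_monoid : monoid_morphism tfrac_of.
Proof.
split=> // a b; rewrite -[RHS]/(tfrac_mul _ _) tfrac_mulE.
by apply: piP => /=; ring.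
Qed.
HB.instance Definition _ :=
  GRing.isZmodMorphism.Build R tfrac tfrac_of tfrac_of_zmod.
HB.instance Definition _ :=
  GRing.isMonoidMorphism.Build R tfrac tfrac_of tfrac_of_monoid.

Definition normalization : set tfrac := [set x | integralOver tfrac_of x].

End TotalFractions.

Section Delta.
(* c is the structure morphism that makes R an F-algebra. *)
Variables (F : fieldType) (R : comNzRingType) (c : {rmorphism F -> R}).

(* The classes of b_0, ..., b_(d-1) form a basis of the F-vector space
   (normalization R) / R. *)
Definition quotient_basis (d : nat) (b : 'I_d -> tfrac R) : Prop :=
  (forall i, normalization (b i)) /\
  (forall x, normalization x -> exists! a : {ffun 'I_d -> F}, exists r : R,
     x = \sum_(i < d) tfrac_of (c (a i)) * b i + tfrac_of r).

(* dim_F of (normalization R) / R; it is set to 0 if infinite. *)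
Definition delta : nat :=
  xget 0%N [set d | exists b : 'I_d -> tfrac R, quotient_basis b].

End Delta.

Section SubringAlgebra.
Variables (F A : comNzRingType) (c : {rmorphism F -> A}).
Variables (S : subringClosed A) (cS : forall a, c a \in S).

Definition subring_of : Type := {x : A | x \in S}.
HB.instance Definition _ := SubChoice.on subring_of.
HB.instance Definition _ := [SubChoice_isSubComNzRing of subring_of by <:].

Definition subring_scalar (a : F) : subring_of := exist _ (c a) (cS a).

Fact subring_scalar_zmod : zmod_morphism subring_scalar.
Proof. by move=> a b; apply: val_inj; rewrite /= rmorphB. Qed.
Fact subring_scalar_monoid : monoid_morphism subring_scalar.
Proof.
by split=> [|a b]; apply: val_inj; rewrite /= ?rmorph1 ?rmorphM.
Qed.
HB.instance Definition _ := GRing.isZmodMorphism.Build F subring_of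
  subring_scalar subring_scalar_zmod.
HB.instance Definition _ := GRing.isMonoidMorphism.Build F subring_of
  subring_scalar subring_scalar_monoid.

End SubringAlgebra.

(* F[[T^2, T^(2m+1)]]: the series sum_(i, j) a_ij T^(2i + (2m+1)j); the terms
   contributing to the coefficient of T^k have i, j <= k. *)
Section Cusp.
Variables (F : fieldType) (m : nat).

Definition in_cusp : {pred fps F} := fun f =>
  `[< exists a : nat -> nat -> F, forall k, fps_coef f k =
        \sum_(i < k.+1) \sum_(j < k.+1 | (2 * i + (2 * m + 1) * j == k)%N)
          a i j >].

Lemma in_cuspP f :
  reflect (forall k, odd k -> (k < 2 * m + 1)%N -> fps_coef f k = 0) (in_cusp f).
Proof.
apply: (iffP (asboolP _)) => [[a fa] k ok km|f0].
  rewrite fa big1 // => i _; rewrite big1 // => j /eqP e.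
  by case: (nat_of_ord j) e => [|l]; nia.
exists (fun i j => if j == 0%N then fps_coef f (2 * i)
          else if j == 1%N then fps_coef f (2 * i + (2 * m + 1)) else 0) => k.
case ok: (odd k); last first.
  have k2 : (k./2 < k.+1)%N by lia.
  rewrite (bigD1 (Ordinal k2)) //= (bigD1 ord0) /=; last by apply/eqP; lia.
  have -> : (2 * k./2)%N = k by lia.
  rewrite [X in _ + X + _]big1 => [|j /andP[/eqP e j0]]; last first.
    rewrite ifN //; case: eqP => // j1; move: e; rewrite j1; lia.
  rewrite big1 ?addr0 // => i ik; rewrite big1 // => j /eqP e.
  case: eqP => [j0|j0].
    by case/eqP: ik; apply: val_inj => /=; move: e; rewrite j0; lia.
  by case: eqP => // j1; move: e; rewrite j1; lia.
case: (ltnP k (2 * m + 1)) => km.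
  rewrite f0 // big1 // => i _; rewrite big1 // => j /eqP e.
  by case: (nat_of_ord j) e => [|l]; nia.
have k2 : ((k - (2 * m + 1))./2 < k.+1)%N by lia.
have k1 : (1 < k.+1)%N by lia.
rewrite (bigD1 (Ordinal k2)) //= (bigD1 (Ordinal k1)) /=; last by apply/eqP; lia.
have -> : (2 * (k - (2 * m + 1))./2 + (2 * m + 1))%N = k by lia.
rewrite [X in _ + X + _]big1 => [|j /andP[/eqP e j1]]; last first.
  case: eqP => [j0|_]; first by move: e; rewrite j0; lia.
  by rewrite ifN.
rewrite big1 ?addr0 // => i ik; rewrite big1 // => j /eqP e.
case: eqP => [j0|j0]; first by move: e; rewrite j0; lia.
case: eqP => // j1; case/eqP: ik; apply: val_inj => /=.
by move: e; rewrite j1; lia.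
Qed.

Fact in_cusp_subring : subring_closed in_cusp.
Proof.
split=> [|f g /in_cuspP hf /in_cuspP hg|f g /in_cuspP hf /in_cuspP hg];
  apply/in_cuspP => k ok km.
- by case: k ok km.
- by rewrite /= hf // hg // subr0.
rewrite /= big1 // => i _; case oi: (odd i).
  by rewrite hf ?mul0r //; case: i oi => /= i; lia.
by rewrite [X in _ * X]hg ?mulr0 //; case: i oi => /= i; lia.
Qed.
HB.instance Definition _ :=
  GRing.isSubringClosed.Build (fps F) in_cusp in_cusp_subring.

Fact fpsC_in_cusp (a : F) : fpsC a \in in_cusp.
Proof. by apply/in_cuspP => -[]. Qed.

Definition R_cusp : comNzRingType := @subring_of (fps F) in_cusp.
Definition scalar_cusp : {rmorphism F -> R_cusp} :=
  subring_scalar fpsC_in_cusp.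

End Cusp.

(* F[[X, Y]] / (Y (Y - X^m)), where F[[X, Y]] is encoded as F[[X]][[Y]]. *)
Section Split.
Variables (F : fieldType) (m : nat).
Definition varX : fps (fps F) := fpsC (fpsX F).
Definition varY : fps (fps F) := fpsX (fps F).

Definition in_split_ideal : {pred fps (fps F)} := fun f =>
  `[< exists g, f = g * (varY * (varY - varX ^+ m)) >].

Fact split_idealr_closed : idealr_closed in_split_ideal.
Proof.
split.
- by apply/asboolP; exists 0; rewrite mul0r.
- apply/negP => /asboolP[g] /fpsP/(_ 0%N); rewrite mulrCA /=.
  by rewrite big_ord_recl big_ord0 mul0r addr0 => /eqP; rewrite oner_eq0.
move=> a f g /asboolP[f' ->] /asboolP[g' ->]; apply/asboolP.
by exists (a * f' + g'); ring.
Qed.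
HB.instance Definition _ :=
  isIdealr.Build (fps (fps F)) in_split_ideal split_idealr_closed.

Definition R_split : comNzRingType := {ideal_quot in_split_ideal}.
Definition scalar_split : {rmorphism F -> R_split} :=
  \pi_{ideal_quot in_split_ideal} \o (@fpsC (fps F) \o @fpsC F).

End Split.

(* F[[T]] + T^m K[[T]], for K / F of degree 2. *)
Section Inert.
Variables (F : fieldType) (K : fieldExtType F) (m : nat).

Definition in_inert : {pred fps K} := fun f =>
  `[< exists (a : fps F) (b : fps K),
        f = fps_map (in_alg K) a + fpsX K ^+ m * b >].

Fact in_inert_subring : subring_closed in_inert.
Proof.
split=> [|f g|f g].
- by apply/asboolP; exists 1, 0; rewrite rmorph1 mulr0 addr0.
- move=> /asboolP[a [b ->]] /asboolP[a' [b' ->]]; apply/asboolP.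
  by exists (a - a'), (b - b'); rewrite rmorphB; ring.
move=> /asboolP[a [b ->]] /asboolP[a' [b' ->]]; apply/asboolP.
exists (a * a'), (fps_map (in_alg K) a * b' + b * fps_map (in_alg K) a'
                  + fpsX K ^+ m * b * b').
by rewrite rmorphM; ring.
Qed.
HB.instance Definition _ :=
  GRing.isSubringClosed.Build (fps K) in_inert in_inert_subring.

Fact scalar_in_inert (a : F) : (@fpsC K \o in_alg K) a \in in_inert.
Proof.
apply/asboolP; exists (fpsC a), 0; rewrite mulr0 addr0.
by apply/fpsP => -[|k] /=; rewrite ?scale0r.
Qed.

Definition R_inert : comNzRingType := @subring_of (fps K) in_inert.
Definition scalar_inert : {rmorphism F -> R_inert} :=
  subring_scalar scalar_in_inert.

End Inert.

From mathcomp Require Import mpoly.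

Section Master.
Variable L : fieldType.
Implicit Types (A u t z : L).

Definition poch A z (N : nat) : L := \prod_(j < N) (1 - A * z ^+ j).

(* 1 / (z;z)_k, with the convention that it is 0 for k < 0. *)
Definition inv_poch z (k : int) : L :=
  if k is Posz N then (poch z z N)^-1 else 0.

(* With k = (n_1, ..., n_m), [idx k i] is n_i for 1 <= i <= m, and the end
   values are n_0 = 0 and n_(m+1) = n. *)
Definition idx (m n : nat) (k : m.-tuple 'I_n.+1) (i : nat) : nat :=
  nth n (0%N :: [seq nat_of_ord j | j <- k]) i.

(* The summation over all n_1, ..., n_m >= 0 is cut down to n_i <= n: the
   factors 1/(z;z)_(n_(i+1) - n_i), 0 <= i <= m, kill every term which does not
   satisfy n_1 <= ... <= n_m <= n.
   Division in L is total; the formula is the value of the polynomial in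
   Z[u, t, z^-1] only where u, z, (z;z)_k and (u^-1 t z;z)_k, k <= n, are
   nonzero.  This is so for indeterminates u, t, z and after the substitution
   (u, t) := (u^-1 z^(2n), u^-1 t z^n), under which u^-1 t z becomes
   t z^(1-n), and likewise when z is a prime power inverse and t is replaced
   by eps * t with eps in {0, 1, -1}. *)
Definition master (m n : nat) u t z : L :=
  \sum_(k : m.-tuple 'I_n.+1)
    u ^ ((m * n)%:Z - \sum_(1 <= i < m.+1) (idx k i)%:Z)
    * z ^ (- (m * n ^ 2)%:Z + \sum_(1 <= i < m.+1) (idx k i ^ 2)%:Z)
    * poch z z n * poch (u^-1 * t * z) z n
    * (\prod_(0 <= i < m.+1) inv_poch z ((idx k i.+1)%:Z - (idx k i)%:Z))
    / poch (u^-1 * t * z) z (idx k 1).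

End Master.

(* Z[x_0, ..., x_(k-1)] embeds in Q(x_0, ..., x_(k-1)), and so do the Laurent
   polynomials. *)
Notation ratfun k := {fraction {mpoly int[k]}}.

Definition indet (k : nat) (i : 'I_k) : ratfun k := FracField.tofrac 'X_i.

Variant ring_family := CuspR | SplitR | InertR.

Definition eps (r : ring_family) : int :=
  match r with CuspR => 0 | SplitR => 1 | InertR => -1 end.

Definition Z_R (L : fieldType) (r : ring_family) (m n : nat) (u t : L) (q : nat) : L :=
  master m n u ((eps r)%:~R * t) q%:R^-1.

(* Main.v *)
From HB Require Import structures.
Require Import Defs.
From mathcomp Require Import all_boot all_order all_algebra falgebra fieldext.
From mathcomp Require Import boolp mpoly ring zify.
Set Implicit Arguments.
Unset Strict Implicit.
Unset Printing Implicit Defensive.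
Import GRing.Theory.
Local Open Scope ring_scope.

(** Put [v = u^-1] and write [(A)_k] for [(A; z)_k].  Up to the factor
    [u^(mn) z^(-mn^2) (z)_n (vtz)_n], the master polynomial is the sum over
    chains [n_1 <= ... <= n_m <= n] of
    [prod_i v^(n_i) z^(n_i^2) / (z)_(n_(i+1) - n_i)] against
    [1 / ((z)_(n_1) (vtz)_(n_1))].  This is the [m]-fold iterate of the
    limiting Bailey lemma (both parameters sent to infinity) on the sequence
    [beta_r = 1 / ((z)_r (vtz)_r)].  That sequence belongs to an explicit
    Bailey pair: [bailey_base] writes it as a single sum, a limit of the
    terminating very-well-poised 6phi5 sum.  One Bailey step only multiplies
    the [s]-th summand by [v^s z^(s^2)]; this is the q-Chu-Vandermonde sum, see
    [q_vandermonde], [bailey_kernel] and [bailey_step].  So the multiple sum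
    collapses to [sum_(s <= n) bailey_term (m+1) n s] ([chain_sum]).  In this
    form the functional equation holds term by term: under
    [(u, t) := (u^-1 z^(2n), u^-1 t z^n)] the [s]-th summand is exchanged with
    the [(n - s)]-th ([bailey_term_reflect]).  All this takes place in a field
    where [u] and [t] are generic with respect to powers of [z]; for
    indeterminates genericity is seen by evaluating at small integer points.

    For the three rings the claim is the specialisation [z = q^-1], [t := eps t]
    of this equation, once [delta = m] is known.  The normalizations are
    [F[[T]]], [F[[X]] x F[[X]]] and [K[[T]]].  In each case the overring [A]
    contains [R], a power of the uniformizer conducts [A] into [R], every
    element of [A] is quadratic over [R], and [A] is integrally closed because
    a power series over a field is a power of the variable times a unit; hence
    [A] is the normalization ([delta_overring]).  Explicit bases of [A / R] are
    the [T^(2i+1)], the [(0, X^i)] and the [theta T^i] with [i < m], where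
    [K = F + F theta].  Since [F] is finite, the dimension of [A / R] is
    well defined by counting. *)

(** * q-shifted factorials *)

Section Poch.
Variable L : fieldType.
Implicit Types A z x : L.

Lemma poch0 A z : poch A z 0 = 1.
Proof. by rewrite /poch big_ord0. Qed.

Lemma pochSr A z N : poch A z N.+1 = poch A z N * (1 - A * z ^+ N).
Proof. by rewrite /poch big_ord_recr. Qed.

Lemma pochD A z M N : poch A z (M + N) = poch A z M * poch (A * z ^+ M) z N.
Proof.
rewrite /poch big_split_ord; congr (_ * _).
by apply: eq_bigr => j _ /=; rewrite exprD mulrA.
Qed.

Lemma pochSl A z N : poch A z N.+1 = (1 - A) * poch (A * z) z N.
Proof. by rewrite -add1n pochD pochSr poch0 mul1r mulr1 expr1. Qed.

Lemma poch_neq0 A z N :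
  (forall j, (j < N)%N -> A * z ^+ j != 1) -> poch A z N != 0.
Proof.
move=> nz; apply/prodf_neq0 => j _; rewrite subr_eq0 eq_sym.
exact: nz.
Qed.

(** [x^N (x^-1; z)_N], in the form that keeps its meaning at [x = 0]. *)
Definition falling x z N : L := \prod_(j < N) (x - z ^+ j).

Lemma fallingS x z N : falling x z N.+1 = falling x z N * (x - z ^+ N).
Proof. by rewrite /falling big_ord_recr. Qed.

Lemma prod_geometric z N : \prod_(j < N) z ^+ j = z ^+ 'C(N, 2).
Proof.
elim: N => [|N IH]; first by rewrite big_ord0 expr0.
by rewrite big_ord_recr /= IH -exprD binS bin1.
Qed.

(** Reading the product backwards pairs the factor [1 - B z^(N-j)] with
    [1 - A z^j], and these are proportional because [A B z^N = 1]. *)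
Lemma poch_rev A B z N : A * B * z ^+ N = 1 ->
  poch B z N.+1 = (-1) ^+ N.+1 * B ^+ N.+1 * z ^+ 'C(N.+1, 2) * poch A z N.+1.
Proof.
move=> AB; rewrite -prod_geometric /poch.
rewrite (reindex_inj rev_ord_inj) [\prod_(j < _) z ^+ j](reindex_inj rev_ord_inj) /=.
transitivity (\prod_(j < N.+1) ((- B * z ^+ (N - j)) * (1 - A * z ^+ j))).
  apply: eq_bigr => j _; rewrite subSS.
  have -> : - B * z ^+ (N - j) * (1 - A * z ^+ j) =
            (A * B) * (z ^+ j * z ^+ (N - j)) - B * z ^+ (N - j) by ring.
  by rewrite -exprD subnKC -1?ltnS // AB.
rewrite big_split /= big_split /= prodr_const card_ord.
by rewrite [(- B) ^+ _]exprNn.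
Qed.

Lemma falling_poch x z N :
  falling (x * z ^+ N) z N = (-1) ^+ N * z ^+ 'C(N, 2) * poch (x * z) z N.
Proof.
rewrite -prod_geometric /poch /falling [LHS](reindex_inj rev_ord_inj).
rewrite [\prod_(j < _) z ^+ j](reindex_inj rev_ord_inj) /=.
rewrite -[N in (-1) ^+ N]card_ord -prodr_const -!big_split /=.
apply: eq_bigr => j _; have -> : z ^+ N = z ^+ (N - j.+1) * z ^+ j * z.
  by rewrite -exprD -exprSr; congr (_ ^+ _); have := ltn_ord j; lia.
ring.
Qed.

End Poch.

(** * Collapsing the multiple sum with Bailey's lemma *)

Section Sums.
Variables (L : fieldType) (z : L).
Hypothesis zfree : forall j, z ^+ j.+1 != 1.

Lemma pochz_neq0 N : poch z z N != 0.
Proof. by apply: poch_neq0 => j _; rewrite -exprS. Qed.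

Lemma pochzS_neq0 N : 1 - z * z ^+ N != 0.
Proof. by rewrite subr_eq0 eq_sym -exprS. Qed.

(** The Wilf-Zeilberger certificate of [q_vandermonde]: normalised to have sum
    [1], the summand changes between [N] and [N + 1] by a telescoping term.
    The partial sums stop at [N] because the truncated [N - k] would give the
    summand of index [N + 1] a meaningless value for [N]. *)
Lemma q_vandermonde_gap V N j (Vfree : forall j, V * z ^+ j.+1 != 1) :
  (j <= N)%N ->
  let U N k := V ^+ k * z ^+ (k ^ 2)
    / (poch z z (N - k) * poch z z k * poch (V * z) z k)
    * (poch z z N * poch (V * z) z N) in
  \sum_(k < j.+1) (U N.+1 k - U N k) =
  - (z ^+ (N - j) * V ^+ j.+1 * z ^+ (j.+1 ^ 2)
     * (poch z z N * poch (V * z) z N)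
    / (poch z z (N - j) * poch z z j * poch (V * z) z j)).
Proof.
move=> jN U.
have pV k : poch (V * z) z k != 0.
  by apply: poch_neq0 => i _; rewrite -mulrA -exprS.
have pVS k : 1 - V * z * z ^+ k != 0.
  by rewrite subr_eq0 eq_sym -mulrA -exprS.
elim: j jN => [|j IH] jN.
  rewrite big_ord1 /U !subn0 !poch0 !expr0 !pochSr expr1.
  field; by rewrite ?pochz_neq0 ?pochzS_neq0 ?pV ?pVS.
rewrite big_ord_recr /= IH 1?ltnW // /U.
have [d ->] : exists d, N = (j + d).+1 by exists (N - j.+1)%N; lia.
have -> : ((j + d).+1 - j = d.+1)%N by lia.
have -> : ((j + d).+1 - j.+1 = d)%N by lia.
have -> : ((j + d).+2 - j.+1 = d.+1)%N by lia.
have -> : (j.+2 ^ 2 = j ^ 2 + j * 4 + 4)%N by lia.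
have -> : (j.+1 ^ 2 = j ^ 2 + j * 2 + 1)%N by lia.
rewrite ![poch _ _ _.+1]pochSr.
have := pVS j; have := pVS (j + d)%N.
have := pochzS_neq0 j; have := pochzS_neq0 (j + d)%N; have := pochzS_neq0 d.
move: (j ^ 2)%N => J.
rewrite !exprD !exprM !(exprS, exprD, expr0).
(* The factors common to all terms and the powers become atoms. *)
have := (pochz_neq0 j, pochz_neq0 d, pV j, pV (j + d)%N, pochz_neq0 (j + d)).
move: (poch z z j) (poch z z d) (poch (V * z) z j) (poch (V * z) z (j + d)).
move: (poch z z (j+d)) (z ^+ j) (z ^+ d) (V ^+ j) (z ^+ J).
move=> e1 e2 e3 e4 e5 e6 e7 e8 e9 [[[[h1 h2] h3] h4] h5] k1 k2 k3 k4 k5.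
by field; rewrite k5 h3 k3 h1 h2 k1.
Qed.

Lemma q_vandermonde V N (Vfree : forall j, V * z ^+ j.+1 != 1) :
  \sum_(k < N.+1) V ^+ k * z ^+ (k ^ 2)
    / (poch z z (N - k) * poch z z k * poch (V * z) z k)
  = (poch z z N * poch (V * z) z N)^-1.
Proof.
have pV k : poch (V * z) z k != 0.
  by apply: poch_neq0 => i _; rewrite -mulrA -exprS.
have nz M : poch z z M * poch (V * z) z M != 0.
  by rewrite mulf_neq0 ?pochz_neq0.
apply: (mulIf (nz N)); rewrite mulVf // mulr_suml.
elim: N => [|N IH].
  by rewrite big_ord1 !poch0 !expr0 !mulr1 divr1.
have /= := q_vandermonde_gap Vfree (leqnn N); rewrite sumrB IH => /eqP.
rewrite subr_eq => /eqP gap; rewrite big_ord_recr /= gap.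
rewrite !subnn !poch0.
by field; rewrite ?pV ?pochz_neq0.
Qed.

Variables (v t : L).
Hypothesis vfree : forall j, v * z ^+ j != 1.
Hypothesis vtfree : forall j, v * t * z ^+ j.+1 != 1.

(** [v^((m-1)s) z^((m-1)s^2) alpha_s / ((z)_(N-s) (vz)_(N+s))], where [alpha]
    and [1 / ((z)_r (vtz)_r)] form a Bailey pair relative to [v].  The factors
    [(v)_s / ((1 - v) (vz)_(N+s))] are merged into [1 / (v z^s)_(N+1)], and
    [t^s (t^-1)_s] into [falling t z s]. *)
Definition bailey_term m N s : L :=
  v ^+ (m * s) * z ^+ (m * s ^ 2) * falling t z s * (1 - v * z ^+ (2 * s))
  / (poch z z s * poch z z (N - s) * poch (v * z ^+ s) z N.+1
     * poch (v * t * z) z s).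

Lemma poch_v_neq0 s N : poch (v * z ^+ s) z N != 0.
Proof. by apply: poch_neq0 => i _; rewrite -mulrA -exprD. Qed.

Lemma poch_vt_neq0 N : poch (v * t * z) z N != 0.
Proof. by apply: poch_neq0 => i _; rewrite -mulrA -exprS. Qed.

(** The Wilf-Zeilberger certificate of [bailey_base], in the same form as
    [q_vandermonde_gap]. *)
Lemma bailey_base_gap N j : (j <= N)%N ->
  let U N k := bailey_term 1 N k * (poch z z N * poch (v * t * z) z N) in
  \sum_(k < j.+1) (U N.+1 k - U N k) =
  - (v ^+ j.+1 * z ^+ (j ^ 2 + N + j.+1) * falling t z j.+1
     * (poch z z N * poch (v * t * z) z N)
    / (poch z z (N - j) * poch z z j * poch (v * z ^+ j.+1) z N.+1
       * poch (v * t * z) z j)).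
Proof.
move=> jN U.
have vS k : 1 - v * z ^+ k != 0 by rewrite subr_eq0 eq_sym.
have vtS k : 1 - v * t * z * z ^+ k != 0.
  by rewrite subr_eq0 eq_sym -mulrA -exprS.
elim: j jN => [|j IH] jN.
  rewrite big_ord1 /U /bailey_term !subn0 !poch0 !muln0 !expr0 !mulr1.
  rewrite !(pochSl v) [poch (v * z ^+ 1) z N.+1]pochSr.
  rewrite ![poch _ _ N.+1]pochSr /falling big_ord0 big_ord1 !expr1.
  have := (poch_v_neq0 1 N, vS N.+1, vS 0%N, pochz_neq0, pochzS_neq0).
  have := (poch_vt_neq0 N, vtS N).
  rewrite !expr0 !mulr1 expr1 add0n addn1 !exprS.
  move=> [a1 a2] [[[[a3 a4] a5] a6] a7].
  by field; rewrite -mulrA a4 a3 a5 a6 a7.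
rewrite big_ord_recr /= IH 1?ltnW // /U /bailey_term.
have [d ->] : exists d, N = (j + d).+1 by exists (N - j.+1)%N; lia.
have -> : ((j + d).+1 - j = d.+1)%N by lia.
have -> : ((j + d).+1 - j.+1 = d)%N by lia.
have -> : ((j + d).+2 - j.+1 = d.+1)%N by lia.
have -> : (j.+1 ^ 2 = j ^ 2 + j * 2 + 1)%N by lia.
have -> : (2 * j.+1 = j * 2 + 2)%N by lia.
rewrite !(pochSl (v * z ^+ j.+1)).
have -> : v * z ^+ j.+1 * z = v * z ^+ j.+2 by rewrite -mulrA -exprSr.
rewrite [poch (v * z ^+ j.+2) z (j + d).+2]pochSr [poch _ _ j.+1]pochSr.
rewrite [poch (v * t * z) _ j.+1]pochSr.
rewrite ![poch _ z (j + d).+2]pochSr [poch z z d.+1]pochSr ![falling _ _ _.+1]fallingS.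
have := (poch_v_neq0 j.+2 (j + d).+1, vS j.+1, vS (j.+2 + (j + d).+1)%N).
have := (pochz_neq0 j, pochz_neq0 d, pochzS_neq0 j, pochzS_neq0 d).
have := (poch_vt_neq0 j, vtS j).
move: (poch (v * z ^+ _) _ _) (poch z z (j + d).+1) (poch z z j) (poch z z d).
move: (poch _ _ (j + d).+1) (poch _ _ j) (falling _ _ _) (j ^ 2)%N => e1 e2 e3 J.
rewrite mul1n !exprD !exprM !(exprS, exprD, expr0).
move=> e4 e5 e6 e7 [h1 h2] [[[h3 h4] h5] h6] [[h7 h8] h9].
by field; rewrite h2 h1 -(mulrA v (z * _)) h9 h7 h5 h3 h4 h8 h6.
Qed.

(** A limit of the terminating very-well-poised 6phi5 sum. *)
Lemma bailey_base N :
  \sum_(s < N.+1) bailey_term 1 N s = (poch z z N * poch (v * t * z) z N)^-1.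
Proof.
have nz M : poch z z M * poch (v * t * z) z M != 0.
  by rewrite mulf_neq0 ?pochz_neq0 ?poch_vt_neq0.
apply: (mulIf (nz N)); rewrite mulVf // mulr_suml.
elim: N => [|N IH].
  rewrite big_ord1 /bailey_term /falling !big_ord0 !poch0 !expr0 !mulr1.
  by rewrite !mul1r pochSr poch0 expr0 mul1r mulr1 divff //
    subr_eq0 eq_sym -[v]mulr1; exact: (vfree 0).
have /= := bailey_base_gap (leqnn N); rewrite sumrB IH => /eqP.
rewrite subr_eq => /eqP gap; rewrite big_ord_recr /= gap.
rewrite /bailey_term !subnn !poch0 [poch _ _ N.+2]pochSr.
have vS k : 1 - v * z ^+ k != 0 by rewrite subr_eq0 eq_sym.
have := (poch_v_neq0 N.+1 N.+1, vS (N.+1 + N.+1)%N, pochz_neq0 N, pochz_neq0 N.+1).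
have := (poch_vt_neq0 N, poch_vt_neq0 N.+1).
have -> : (N.+1 ^ 2 = N ^ 2 + N + N.+1)%N by lia.
have -> : (2 * N.+1 = N.+1 + N.+1)%N by lia.
rewrite !mul1n.
rewrite (exprD z N.+1) => [[h1 h2]] [[[h3 h4] h5] h6].
by field; rewrite h2 -(mulrA v (z ^+ _)) h4 h3 h6 h1 h5.
Qed.

(** As a function of [N], the kernel of the Bailey transform is an eigenvector
    of the Bailey step: after the shift [r = s + k] this is [q_vandermonde] at [V = v z^(2s)],
    because [(v z^s)_(s+k+1) = (v z^s)_(s+1) (V z)_k]. *)
Lemma bailey_kernel s N : (s <= N)%N ->
  \sum_(s <= r < N.+1) v ^+ r * z ^+ (r ^ 2)
    / (poch z z (N - r) * poch z z (r - s) * poch (v * z ^+ s) z r.+1)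
  = v ^+ s * z ^+ (s ^ 2) / (poch z z (N - s) * poch (v * z ^+ s) z N.+1).
Proof.
move=> sN; set V := v * z ^+ (2 * s).
have Vfree j : V * z ^+ j.+1 != 1 by rewrite -mulrA -exprD.
have split_v k : poch (v * z ^+ s) z (k + s).+1 =
    poch (v * z ^+ s) z s.+1 * poch (V * z) z k.
  rewrite addnC -addSn pochD; congr (_ * poch _ _ _).
  by rewrite /V -!mulrA -!exprD -exprSr; congr (_ * _ ^+ _); lia.
rewrite -{1}[s]add0n big_addn subSn // big_mkord.
have -> : poch (v * z ^+ s) z N.+1 = poch (v * z ^+ s) z s.+1 * poch (V * z) z (N - s).
  by rewrite -split_v subnK.
transitivity (v ^+ s * z ^+ (s ^ 2) / poch (v * z ^+ s) z s.+1 *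
    (\sum_(k < (N - s).+1) V ^+ k * z ^+ (k ^ 2)
    / (poch z z (N - s - k) * poch z z k * poch (V * z) z k))).
  rewrite mulr_sumr; apply: eq_bigr => k _.
  rewrite addnK split_v (_ : N - (k + s) = N - s - k)%N; last by lia.
  have -> : ((k + s) ^ 2 = s ^ 2 + 2 * s * k + k ^ 2)%N by lia.
  have -> : V ^+ k = v ^+ k * z ^+ (2 * s * k) by rewrite exprMn (exprM z (2 * s)).
  rewrite (exprD v) (exprD z _ (k ^ 2)) (exprD z (s ^ 2)) !invfM; ring.
rewrite q_vandermonde // !invfM; ring.
Qed.

(** One step of the Bailey chain, by exchanging the two sums. *)
Lemma bailey_step M N :
  \sum_(r < N.+1) v ^+ r * z ^+ (r ^ 2) / poch z z (N - r)
     * (\sum_(s < r.+1) bailey_term M r s)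
  = \sum_(s < N.+1) bailey_term M.+1 N s.
Proof.
transitivity (\sum_(r < N.+1) \sum_(s < N.+1 | (s < r.+1)%N)
    v ^+ r * z ^+ (r ^ 2) / poch z z (N - r) * bailey_term M r s).
  apply: eq_bigr => r _; rewrite mulr_sumr.
  by rewrite (big_ord_widen _ (fun s => _ * bailey_term M r s) (ltn_ord r)).
rewrite (exchange_big_dep xpredT) //=; apply: eq_bigr => s _.
have sN : (s <= N)%N by rewrite -ltnS.
transitivity (v ^+ (M * s) * z ^+ (M * s ^ 2) * falling t z s
    * (1 - v * z ^+ (2 * s)) / (poch z z s * poch (v * t * z) z s)
    * (\sum_(s <= r < N.+1) v ^+ r * z ^+ (r ^ 2)
    / (poch z z (N - r) * poch z z (r - s) * poch (v * z ^+ s) z r.+1))).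
  rewrite big_geq_mkord mulr_sumr; apply: eq_big => // r _.
  by rewrite /bailey_term !invfM; ring.
rewrite bailey_kernel // /bailey_term !mulSn !exprD !invfM; ring.
Qed.

(** The indices [n_i] of a chain whose final value [n_(m+1) = N] is decoupled
    from the range [n] of the summation variables.  Removing the last variable
    then leaves a chain of the same kind, with that variable as final value. *)
Definition level (n N m : nat) (k : m.-tuple 'I_n.+1) (i : nat) : nat :=
  nth N (0%N :: [seq nat_of_ord j | j <- k]) i.

Definition chain_term n m N (k : m.-tuple 'I_n.+1) : L :=
  v ^+ (\sum_(1 <= i < m.+1) level N k i)
  * z ^+ (\sum_(1 <= i < m.+1) level N k i ^ 2)
  * (\prod_(0 <= i < m.+1)
       inv_poch z ((level N k i.+1)%:Z - (level N k i)%:Z))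
  / poch (v * t * z) z (level N k 1).

Lemma level_rcons n N m (k : m.-tuple 'I_n.+1) (r : 'I_n.+1) i :
  (i <= m.+1)%N -> level N [tuple of rcons k r] i = level r k i.
Proof.
move=> im; rewrite /level /= map_rcons -rcons_cons nth_rcons /= size_map size_tuple.
case: (ltngtP i m.+1) im => // [im _|-> _].
  by apply: set_nth_default; rewrite /= size_map size_tuple.
by apply/esym/nth_default; rewrite /= size_map size_tuple.
Qed.

Lemma level_last n N m (k : m.-tuple 'I_n.+1) : level N k m.+1 = N.
Proof. by apply: nth_default; rewrite /= size_map size_tuple. Qed.

Lemma chain_term_rcons n N m (k : m.-tuple 'I_n.+1) (r : 'I_n.+1) :
  chain_term N [tuple of rcons k r] =
  v ^+ r * z ^+ (r ^ 2) * inv_poch z (N%:Z - r%:Z) * chain_term r k.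
Proof.
have sum_rcons (f : nat -> nat) :
    \sum_(1 <= i < m.+2) f (level N [tuple of rcons k r] i) =
    (\sum_(1 <= i < m.+1) f (level r k i) + f r)%N.
  rewrite big_nat_recr //= level_rcons // level_last; congr addn.
  by apply: eq_big_nat => i /andP[_ im]; rewrite level_rcons // ltnW.
rewrite /chain_term level_rcons // (sum_rcons id) (sum_rcons (fun i => i ^ 2)%N).
rewrite (big_nat_recr m.+1) // level_last level_rcons // level_last !exprD.
rewrite (eq_big_nat _ _ (F2 := fun i =>
  inv_poch z ((level r k i.+1)%:Z - (level r k i)%:Z))); last first.
  by move=> i /andP[_ im]; rewrite !level_rcons // ltnW.
rewrite /=; ring.
Qed.

Lemma sum_rcons_tuple (T : finType) m (F : m.+1.-tuple T -> L) :
  \sum_k F k = \sum_(r : T) \sum_(k : m.-tuple T) F [tuple of rcons k r].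
Proof.
rewrite pair_bigA /=.
rewrite (reindex (fun p : T * m.-tuple T => [tuple of rcons p.2 p.1])) //=.
exists (fun k : m.+1.-tuple T =>
  (last (thead k) (behead k), [tuple of belast (thead k) (behead k)])).
  move=> [r k] _ /=; set t' := [tuple of rcons k r].
  have := congr1 val (tuple_eta t'); rewrite /= lastI => /rcons_inj[kE rE].
  by congr pair => //; apply: val_inj.
by move=> k _; apply: val_inj; rewrite [in RHS](tuple_eta k) /= -lastI.
Qed.

(** The Bailey chain: induction on [m] by splitting off the last variable. *)
Lemma chain_sum m n N : (N <= n)%N ->
  \sum_(k : m.-tuple 'I_n.+1) chain_term N k
  = \sum_(s < N.+1) bailey_term m.+1 N s.
Proof.
elim: m N => [|m IH] N Nn.
  rewrite bailey_base (big_pred1 [tuple]) => [|k]; last first.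
    by apply/esym/eqP/val_inj; case: k => -[].
  rewrite /chain_term !(big_geq (leqnn 1)) big_nat1 level_last invfM.
  by rewrite /level /= addn0 !expr0 !mul1r.
rewrite (sum_rcons_tuple (@chain_term n m.+1 N)) -bailey_step.
rewrite (big_ord_widen n.+1 (fun r => v ^+ r * z ^+ (r ^ 2) / poch z z (N - r)
     * \sum_(s < r.+1) bailey_term m.+1 r s)) ?ltnS //.
rewrite [RHS]big_mkcond /=; apply: eq_bigr => r _.
under eq_bigr do rewrite chain_term_rcons.
rewrite -mulr_sumr IH -1?ltnS //; case: ltnP => rN.
  by rewrite subzn // -ltnS.
(* For r > N the summand vanishes, as 1/(z;z)_k = 0 for k < 0. *)
by rewrite (_ : _ - _ = Negz (r - N.+1)) ?mulr0 ?mul0r //; lia.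
Qed.

End Sums.

(** * The functional equation over a field *)

Section Reflection.
Variables (L : fieldType) (z v t v' t' : L) (n : nat).
Hypothesis z0 : z != 0.
Hypothesis zfree : forall j, z ^+ j.+1 != 1.
Hypothesis vfree : forall j, v * z ^+ j != 1.
Hypothesis vtfree : forall j, v * t * z ^+ j.+1 != 1.
Hypothesis vtfree' : forall j, v' * t' * z ^+ j.+1 != 1.
Hypothesis vv' : v * v' * z ^+ (2 * n) = 1.
Hypothesis t'E : t' = v * t * z ^+ n.

(** With [v' = v^-1 z^(-2n)] and [t' = v t z^n], each group of factors on one
    side is the reversal of a group on the other: [(v' z^r)_(n+1)] of
    [(v z^s)_(n+1)], the falling product in [t'] of the top part of [(vtz)_n],
    and the top part of [(v't'z)_n] of the falling product in [t].  What
    remains is the monomial identity [scalar]. *)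
Lemma bailey_term_reflect m s r : (s + r)%N = n ->
  poch (v * t * z) z n * bailey_term z v t m.+1 n s =
  v ^+ (m * n) * z ^+ (m * n ^ 2) *
  (poch (v' * t' * z) z n * bailey_term z v' t' m.+1 n r).
Proof.
move=> sr.
have v'0 : v' != 0.
  by apply: contra_eq_neq vv' => ->; rewrite mulr0 mul0r eq_sym oner_neq0.
have tE : v' * t' * z ^+ n = t.
  rewrite t'E (_ : _ * _ = v * v' * (z ^+ n * z ^+ n) * t); last by ring.
  by rewrite -exprD addnn -mul2n vv' mul1r.
have wE : poch (v' * z ^+ r) z n.+1 = (-1) ^+ n.+1 * (v' * z ^+ r) ^+ n.+1
    * z ^+ 'C(n.+1, 2) * poch (v * z ^+ s) z n.+1.
  apply: poch_rev; rewrite -vv' mul2n -addnn -{2}sr !exprD; ring.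
have f'E : falling t' z r =
    (-1) ^+ r * z ^+ 'C(r, 2) * poch (v * t * z * z ^+ s) z r.
  rewrite [v * t * z * _]mulrAC -falling_poch; congr falling.
  by rewrite t'E -sr exprD mulrA.
have fE : falling t z s =
    (-1) ^+ s * z ^+ 'C(s, 2) * poch (v' * t' * z * z ^+ r) z s.
  rewrite [v' * t' * z * _]mulrAC -falling_poch; congr falling.
  by rewrite -tE -sr addnC exprD mulrA.
have v'E : 1 - v' * z ^+ (2 * r) = - (v' * z ^+ (2 * r)) * (1 - v * z ^+ (2 * s)).
  rewrite mulrBr mulr1 -[X in X - _]vv' -sr mulnDr exprD; ring.
(* The exponents of z agree because 2 C(k,2) + k = k^2; the common factor
   z^(2n (s + m r)) serves to cancel the powers of v against those of v'. *)
have scalar : v ^+ (m.+1 * s) * z ^+ (m.+1 * s ^ 2) * z ^+ 'C(s, 2)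
      * ((v' * z ^+ r) ^+ n.+1 * z ^+ 'C(n.+1, 2)) =
    v ^+ (m * n) * z ^+ (m * n ^ 2) * (v' ^+ (m.+1 * r) * z ^+ (m.+1 * r ^ 2))
      * z ^+ 'C(r, 2) * (v' * z ^+ (2 * r)).
  have zn0 : (z ^+ (2 * n)) ^+ (s + m * r) != 0 by rewrite !expf_neq0.
  apply: (mulIf zn0).
  rewrite ![(_ * _) ^+ n.+1]exprMn -[(z ^+ r) ^+ _]exprM.
  rewrite -[(z ^+ _) ^+ (s + _)]exprM mulnDr exprD.
  transitivity (v ^+ (m * s) * v' ^+ r.+1 * (v * v' * z ^+ (2 * n)) ^+ s
    * z ^+ (m.+1 * s ^ 2 + 'C(s, 2) + r * n.+1 + 'C(n.+1, 2) + 2 * n * (m * r))).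
    rewrite ![(_ * _) ^+ s]exprMn -[(z ^+ _) ^+ s]exprM.
    have -> : v' ^+ n.+1 = v' ^+ r.+1 * v' ^+ s.
      by rewrite -exprD -sr; congr (_ ^+ _); lia.
    rewrite mulSn !exprD; ring.
  transitivity (v ^+ (m * s) * v' ^+ r.+1 * (v * v' * z ^+ (2 * n)) ^+ (m * r)
    * z ^+ (m * n ^ 2 + m.+1 * r ^ 2 + 'C(r, 2) + 2 * r + 2 * n * s)); last first.
    rewrite ![(_ * _) ^+ (m * r)]exprMn -[(z ^+ _) ^+ (m * r)]exprM.
    have -> : v ^+ (m * n) = v ^+ (m * s) * v ^+ (m * r).
      by rewrite -exprD -mulnDr sr.
    rewrite [v' ^+ (m.+1 * r)](_ : _ = v' ^+ r * v' ^+ (m * r)); last first.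
      by rewrite -exprD.
    rewrite exprS !exprD; ring.
  rewrite vv' !expr1n; congr (_ * _ * _ ^+ _).
  have bin2_sq k : ('C(k, 2) * 2 + k = k * k)%N.
    by elim: k => // k IHk; rewrite binS bin1; lia.
  have := (bin2_sq s, bin2_sq r, bin2_sq n.+1).
  rewrite -sr -!mulnn => [[[]]].
  by move: ('C(s, 2)) ('C(r, 2)) ('C(_, 2)) => a b c; lia.
rewrite /bailey_term wE f'E fE v'E.
rewrite (_ : n - s = r)%N; last by lia.
rewrite (_ : n - r = s)%N; last by lia.
have -> : poch (v * t * z) z n =
    poch (v * t * z) z s * poch (v * t * z * z ^+ s) z r by rewrite -sr pochD.
have -> : poch (v' * t' * z) z n =
    poch (v' * t' * z) z r * poch (v' * t' * z * z ^+ r) z s.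
  by rewrite -sr addnC pochD.
have -> : (-1) ^+ n.+1 = - ((-1) ^+ s * (-1) ^+ r) :> L.
  by rewrite exprS -sr exprD mulN1r.
have zC0 : z ^+ 'C(n.+1, 2) != 0 by rewrite expf_neq0.
have X0 : (v' * z ^+ r) ^+ n.+1 != 0 by rewrite expf_neq0 // mulf_neq0 ?expf_neq0.
move: (_ ^+ n.+1) X0 scalar => X X0.
move/(canRL (mulfK (mulf_neq0 X0 zC0))) => scalar.
have [zs0 zr0] := (pochz_neq0 zfree s, pochz_neq0 zfree r).
have W0 := poch_v_neq0 vfree s n.+1.
have a0 := poch_vt_neq0 vtfree s; have c0 := poch_vt_neq0 vtfree' r.
transitivity (v ^+ (m.+1 * s) * z ^+ (m.+1 * s ^ 2) * z ^+ 'C(s, 2) *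
  ((-1) ^+ s * poch (v' * t' * z * z ^+ r) z s
   * poch (v * t * z * z ^+ s) z r * (1 - v * z ^+ (2 * s))
   / (poch z z s * poch z z r * poch (v * z ^+ s) z n.+1))).
  by field; rewrite a0 W0 zs0 zr0.
rewrite scalar -{1}[(-1) ^+ s]invr_sign.
have : (-1) ^+ s != 0 :> L by rewrite signr_eq0.
have : (-1) ^+ r != 0 :> L by rewrite signr_eq0.
move: ((-1) ^+ s) ((-1) ^+ r) => p q q0 p0.
by field; rewrite c0 W0 zC0 X0 oppr_eq0 mulf_neq0 // zs0 zr0 p0.
Qed.
End Reflection.

Lemma master_bailey (L : fieldType) (m n : nat) (u t z : L) :
  u != 0 -> z != 0 ->
  (forall j, z ^+ j.+1 != 1) -> (forall j, u^-1 * z ^+ j != 1) ->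
  (forall j, u^-1 * t * z ^+ j.+1 != 1) ->
  master m n u t z = u ^+ (m * n) * z ^- (m * n ^ 2) * poch z z n *
    (poch (u^-1 * t * z) z n * \sum_(s < n.+1) bailey_term z u^-1 t m.+1 n s).
Proof.
move=> u0 z0 zfree vfree vtfree.
have sumZ (f : nat -> nat) :
    \sum_(1 <= i < m.+1) (f i)%:Z = (\sum_(1 <= i < m.+1) f i)%N%:Z.
  by rewrite (big_morph Posz PoszD (erefl _)).
rewrite -(chain_sum zfree vfree vtfree m (leqnn n)) /master !mulr_sumr.
apply: eq_bigr => k _; rewrite !sumZ /chain_term.
rewrite !expfzDr // -!exprnN -!exprnP exprVn -[idx k]/(level n k).
ring.
Qed.

(** No two of [u], [t], [1] differ by a power of [z].  The transformed arguments
    inherit this, so that no denominator vanishes on either side. *)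
Lemma master_functional_equation (L : fieldType) (m n : nat) (u t z : L) :
  u != 0 -> z != 0 -> (forall j, z ^+ j.+1 != 1) ->
  (forall a b, u * z ^+ a != z ^+ b) ->
  (forall a b, u * z ^+ a != t * z ^+ b) ->
  (forall a b, t * z ^+ a != z ^+ b) ->
  master m n u t z =
    u ^+ (m * n) * z ^- (m * n ^ 2)
    * master m n (u^-1 * z ^+ (2 * n)) (u^-1 * t * z ^+ n) z.
Proof.
move=> u0 z0 zfree hu hut ht.
set u' := u^-1 * _; set t' := u^-1 * t * _.
have zX k : z ^+ k != 0 by rewrite expf_neq0.
have u'0 : u' != 0 by rewrite mulf_neq0 ?invr_eq0.
have u'V : u'^-1 = u / z ^+ (2 * n) by rewrite /u' invfM invrK.
have v't' : u'^-1 * t' = t / z ^+ n.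
  rewrite u'V /t' mul2n -addnn exprD; field; exact/andP.
have free1 j : u^-1 * z ^+ j != 1.
  by apply: contraNneq (hu 0 j) => e; rewrite mulr1 -[u]mulr1 -e mulVKf.
have free2 j : u^-1 * t * z ^+ j.+1 != 1.
  by apply: contraNneq (hut 0 j.+1) => e; rewrite mulr1 -[u]mulr1 -e -mulrA mulVKf.
have free3 j : u'^-1 * z ^+ j != 1.
  apply: contraNneq (hu j (2 * n)%N) => e.
  by rewrite -[z ^+ (2 * n)]mul1r -e u'V mulrAC divfK.
have free4 j : u'^-1 * t' * z ^+ j.+1 != 1.
  apply: contraNneq (ht j.+1 n) => e.
  by rewrite -[z ^+ n]mul1r -e v't' mulrAC divfK.
rewrite !master_bailey //.
have -> : u' ^+ (m * n) * z ^- (m * n ^ 2) = u^-1 ^+ (m * n) * z ^+ (m * n ^ 2).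
  rewrite exprMn -exprM -mulrA; congr (_ * _); apply: (mulIf (zX (m * n ^ 2)%N)).
  by rewrite divfK // -exprD; congr (_ ^+ _); rewrite -mulnn; lia.
have -> : poch (u^-1 * t * z) z n * (\sum_(s < n.+1) bailey_term z u^-1 t m.+1 n s)
    = u^-1 ^+ (m * n) * z ^+ (m * n ^ 2) * (poch (u'^-1 * t' * z) z n
      * (\sum_(s < n.+1) bailey_term z u'^-1 t' m.+1 n s)).
  rewrite !mulr_sumr [RHS](reindex_inj rev_ord_inj) /=; apply: eq_bigr => s _.
  apply: bailey_term_reflect => //; last by have := ltn_ord s; lia.
  by rewrite u'V mulKf // mulVf.
ring.
Qed.

(** * Generic arguments in rational function fields *)

Lemma mevalXn (R : comNzRingType) k (v : 'I_k -> R) (p : {mpoly R[k]}) d :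
  meval v (p ^+ d) = meval v p ^+ d.
Proof. exact: rmorphXn. Qed.

Lemma meval_int (R : comNzRingType) k (v : 'I_k -> R) (d : int) :
  meval v d%:~R = d%:~R.
Proof. exact: rmorph_int. Qed.

(** Distinct values at one integer point separate two polynomials; this is how
    the genericity of the indeterminates is checked. *)
Lemma tofrac_neq k (a : 'I_k -> int) (p q : {mpoly int[k]}) :
  meval a p != meval a q -> FracField.tofrac p != FracField.tofrac q.
Proof. by rewrite tofrac_eq; apply: contra_neq => ->. Qed.

Lemma master_indet_functional_equation m n :
  let u := indet (inord 0 : 'I_3) in
  let t := indet (inord 1 : 'I_3) in
  let z := indet (inord 2 : 'I_3) in
  master m n u t z =
    u ^+ (m * n) * z ^- (m * n ^ 2)
    * master m n (u^-1 * z ^+ (2 * n)) (u^-1 * t * z ^+ n) z.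
Proof.
move=> u t z.
pose at_ (a b c : int) (i : 'I_3) := [:: a; b; c]`_i.
have ev a b c := (mevalXU (at_ a b c), mevalM (at_ a b c), mevalXn (at_ a b c),
  meval0 (at_ a b c), meval1 (at_ a b c)).
apply: master_functional_equation => [||j|a b|a b|a b];
  rewrite /u /t /z /indet -?tofrac0 -?tofrac1 -?tofracXn -?tofracM.
- by apply: (tofrac_neq (a := at_ 1 0 0)); rewrite !ev /at_ !inordK.
- by apply: (tofrac_neq (a := at_ 0 0 1)); rewrite !ev /at_ !inordK.
- by apply: (tofrac_neq (a := at_ 0 0 0)); rewrite !ev /at_ !inordK ?exprS ?mul0r.
- by apply: (tofrac_neq (a := at_ 0 0 1)); rewrite !ev /at_ !inordK ?expr1n ?mul0r.
- by apply: (tofrac_neq (a := at_ 0 1 1)); rewrite !ev /at_ !inordK ?expr1n ?mul0r.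
- by apply: (tofrac_neq (a := at_ 0 0 1)); rewrite !ev /at_ !inordK ?expr1n ?mul0r.
Qed.

Lemma Z_R_functional_equation (r : ring_family) m n q : (1 < q)%N ->
  let u := indet (inord 0 : 'I_2) in
  let t := indet (inord 1 : 'I_2) in
  Z_R r m n u t q = u ^+ (m * n) * q%:R ^+ (m * n ^ 2)
    * Z_R r m n (u^-1 * q%:R ^- (2 * n)) (u^-1 * t * q%:R ^- n) q.
Proof.
move=> q1 u t; set w : ratfun 2 := q%:R.
have wE : w = FracField.tofrac (q%:~R) by rewrite rmorph_int /w pmulrn.
pose at_ (a b : int) (i : 'I_2) := [:: a; b]`_i.
have ev a b := (mevalXU (at_ a b), mevalM (at_ a b), mevalXn (at_ a b),
  meval_int (at_ a b), meval0 (at_ a b), meval1 (at_ a b)).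
have q0 k : (q : int)%:~R ^+ k != 0 :> int.
  by rewrite -pmulrn -natrX Num.Theory.pnatr_eq0 expn_eq0; lia.
have wX k : w ^+ k != 0.
  by rewrite wE -tofracXn -tofrac0 (tofrac_neq (a := at_ 0 0)) // !ev q0.
have cross (x y : ratfun 2) a b :
    (x * w^-1 ^+ a == y * w^-1 ^+ b) = (x * w ^+ b == y * w ^+ a).
  by rewrite !exprVn eqr_div.
rewrite /Z_R -/w -!exprVn.
rewrite (_ : (eps r)%:~R * (u^-1 * t * w^-1 ^+ n) =
             u^-1 * ((eps r)%:~R * t) * w^-1 ^+ n); last by ring.
rewrite -[X in X ^+ (m * n ^ 2)]invrK (exprVn w^-1).
apply: master_functional_equation => [||j|a b|a b|a b].
- by rewrite /u /indet -tofrac0 (tofrac_neq (a := at_ 1 0)) // !ev /at_ inordK.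
- by rewrite invr_eq0 (wX 1%N).
- rewrite exprVn invr_eq1 wE -tofracXn -tofrac1 (tofrac_neq (a := at_ 0 0)) // !ev.
  rewrite -pmulrn -natrX Num.Theory.pnatr_eq1 expnS.
  have qj : (0 < q ^ j)%N by rewrite expn_gt0; lia.
  by apply/eqP; nia.
- rewrite -[X in _ != X]mul1r cross mul1r wE /u /indet -!tofracXn -!tofracM.
  by apply: (tofrac_neq (a := at_ 0 0)); rewrite !ev /at_ inordK // mul0r eq_sym q0.
- rewrite cross wE /u /t /indet -(rmorph_int (@FracField.tofrac _)) -!tofracXn -!tofracM.
  apply: (tofrac_neq (a := at_ 1 0)); rewrite !ev /at_ !inordK //.
  by rewrite mul1r mulr0 mul0r q0.
- rewrite -[X in _ != X]mul1r cross mul1r wE /t /indet.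
  rewrite -(rmorph_int (@FracField.tofrac _)) -!tofracXn -!tofracM.
  apply: (tofrac_neq (a := at_ 0 0)); rewrite !ev /at_ !inordK //.
  by rewrite mulr0 mul0r eq_sym q0.
Qed.

(** * The normalization through an overring *)
Section Dimension.
Variables (F : finFieldType) (R : comNzRingType) (c : {rmorphism F -> R}).

(** Over a finite field, dimensions can be compared by counting: two elements
    with the same coordinates in [b'] differ by an element of [R], hence have
    the same coordinates in [b]. *)
Lemma quotient_basis_le d d' (b : 'I_d -> tfrac R) (b' : 'I_d' -> tfrac R) :
  quotient_basis c b -> quotient_basis c b' -> (d <= d')%N.
Proof.
move=> [bint bP] [_ b'P].
pose comb (a : {ffun 'I_d -> F}) := \sum_(i < d) tfrac_of (c (a i)) * b i.
have comb_int a : normalization (comb a).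
  rewrite /comb /normalization /=; elim/big_ind: _ => [|x y|i _].
  - exact: integral0.
  - exact: integral_add.
  - by apply: integral_mul; [apply: integral_id | apply: bint].
have [f fP] := boolp.choice (fun a => b'P _ (comb_int a)).
have f_inj : injective f.
  move=> a1 a2 f12; have [[r1 e1] _] := fP a1; have [[r2 e2] _] := fP a2.
  have [a [_ aU]] := bP _ (comb_int a1).
  rewrite -(aU a1); last by exists 0; rewrite rmorph0 addr0.
  apply: aU; exists (r1 - r2).
  by rewrite e1 -/(comb a2) e2 f12 rmorphB /=; ring.
have := leq_card f f_inj; rewrite !card_ffun !card_ord leq_exp2l //.
exact: card_finNzRing_gt1.
Qed.

Lemma delta_quotient_basis d (b : 'I_d -> tfrac R) :
  quotient_basis c b -> delta c = d.
Proof.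
move=> bP.
have [b' b'P] : exists b' : 'I_(delta c) -> tfrac R, quotient_basis c b'.
  exact: (classical_sets.xgetPex 0%N (ex_intro (fun d0 => exists b0 : 'I_d0 -> tfrac R,
    quotient_basis c b0) d (ex_intro _ b bP))).
by apply/eqP; rewrite eqn_leq !(quotient_basis_le bP b'P, quotient_basis_le b'P bP).
Qed.
End Dimension.

Section TotalFractions.
Variable R : comNzRingType.

Lemma tfrac_of_unit (s : R) : nonzerodiv s -> exists y, tfrac_of s * y = 1.
Proof.
move=> sP; exists (\pi_(tfrac R)%qT (TRatio 1 sP)).
rewrite -[LHS]/(tfrac_mul _ _) tfrac_mulE; apply/eqmodP/eqP => /=; ring.
Qed.

Lemma tfrac_of_mulI (s : R) : nonzerodiv s -> injective ( *%R (tfrac_of s)).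
Proof.
move=> /tfrac_of_unit[y sy] x1 x2 /(congr1 ( *%R y)).
by rewrite !mulrA ![y * _]mulrC sy !mul1r.
Qed.

Lemma tfrac_ratio (x : tfrac R) :
  exists p s, nonzerodiv s /\ tfrac_of s * x = tfrac_of p.
Proof.
elim/quotW: x => -[p s sP]; exists p, s; split=> //.
by rewrite -[LHS]/(tfrac_mul _ _) tfrac_mulE; apply/eqmodP/eqP => /=; ring.
Qed.
End TotalFractions.

(** Integral closedness in the total ring of fractions, with denominators
    cleared: [P / Q] satisfies a monic equation of degree [n]. *)
Definition integrally_closed (A : comNzRingType) :=
  forall n (C : nat -> A) (P Q : A), GRing.lreg Q ->
  P ^+ n + \sum_(i < n) C i * P ^+ i * Q ^+ (n - i) = 0 ->
  exists a, P = a * Q.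

Section Overring.
Variables (F : finFieldType) (R A : comNzRingType) (c : {rmorphism F -> R}).
Variables (iota : {rmorphism R -> A}) (s : R).
Hypothesis iota_inj : injective iota.
Hypothesis s_reg : GRing.lreg (iota s).
Hypothesis conductor : forall a, exists r, iota r = iota s * a.
Hypothesis quadratic : forall a, exists p q, a * a = iota p * a + iota q.
Hypothesis A_closed : integrally_closed A.
Variables (d : nat) (b : 'I_d -> A).
Hypothesis b_basis : forall a, exists! x : {ffun 'I_d -> F}, exists r,
  a = \sum_(i < d) iota (c (x i)) * b i + iota r.

(** [a |-> (s a) / s] embeds [A] into the total ring of fractions of [R].  Its
    image is integral over [R], and contains every integral fraction because
    [A] is integrally closed; so it is the normalization, and a basis of
    [A / R] transfers. *)
Lemma delta_overring : delta c = d.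
Proof.
have sP : nonzerodiv s.
  apply/nonzerodivP => x y sxy; apply/iota_inj/s_reg.
  by rewrite -!rmorphM sxy.
have [rho rhoE] := boolp.choice conductor.
have [s1 ss1] := tfrac_of_unit sP.
pose phi a := s1 * tfrac_of (rho a).
have sphi a : tfrac_of s * phi a = tfrac_of (rho a) by rewrite mulrA ss1 mul1r.
have phiD a a' : phi (a + a') = phi a + phi a'.
  rewrite -mulrDr -rmorphD; congr (_ * tfrac_of _); apply: iota_inj.
  by rewrite rmorphD !rhoE mulrDr.
have phiM a a' : phi (a * a') = phi a * phi a'.
  apply: (tfrac_of_mulI sP); apply: (tfrac_of_mulI sP).
  rewrite sphi [tfrac_of s * (phi a * _)]mulrA sphi mulrCA sphi -!rmorphM; congr tfrac_of.
  by apply: iota_inj; rewrite !rmorphM !rhoE; ring.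
have phiR r : phi (iota r) = tfrac_of r.
  apply: (tfrac_of_mulI sP); rewrite sphi -rmorphM; congr tfrac_of.
  by apply: iota_inj; rewrite rmorphM rhoE.
have phi_inj : injective phi.
  move=> a a' /(congr1 ( *%R (tfrac_of s))); rewrite !sphi => /tfrac_of_inj e.
  by apply: s_reg; rewrite -!rhoE e.
have phi_comb (x : {ffun 'I_d -> F}) r :
    phi (\sum_(i < d) iota (c (x i)) * b i + iota r) =
    \sum_(i < d) tfrac_of (c (x i)) * phi (b i) + tfrac_of r.
  rewrite phiD phiR; congr (_ + _).
  rewrite (big_morph phi phiD (id1 := 0)); last by rewrite -(rmorph0 iota) phiR rmorph0.
  by apply: eq_bigr => i _; rewrite phiM phiR.
have phi_int a : normalization (phi a).
  have [p [q aa]] := quadratic a.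
  exists ('X^2 - (p%:P * 'X + q%:P)).
    rewrite monicE lead_coefDl ?lead_coefXn // size_polyN size_polyXn.
    rewrite size_MXaddC; case: ifP => // _; by rewrite !ltnS size_polyC_leq1.
  rewrite /root rmorphB rmorphD !rmorphM /= !map_polyC map_polyX /=.
  rewrite hornerD hornerN hornerD !hornerM !hornerX !hornerC.
  by rewrite -phiM aa phiD phiM !phiR; apply/eqP; ring.
have normP x : normalization x -> exists a, x = phi a.
  move=> [P Pmon]; have [p [q [qP qx]]] := tfrac_ratio x.
  move=> /eqP; rewrite horner_coef size_map_poly_id0; last first.
    by rewrite (eqP Pmon) rmorph1 oner_neq0.
  rewrite (polySpred (monic_neq0 Pmon)); set n := (size P).-1 => Px.
  have iq_reg : GRing.lreg (iota q).
    move=> y z qyz; apply: s_reg; rewrite -!rhoE; congr (iota _).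
    move/nonzerodivP: (qP); apply; apply: iota_inj.
    by rewrite !rmorphM !rhoE mulrCA qyz mulrCA.
  (* clearing denominators turns the monic equation of p/q into one over R *)
  have [|a ia] := @A_closed n (fun i => iota P`_i) (iota p) (iota q) iq_reg.
    suff e : p ^+ n + \sum_(i < n) P`_i * p ^+ i * q ^+ (n - i) = 0.
      transitivity (iota (p ^+ n + \sum_(i < n) P`_i * p ^+ i * q ^+ (n - i)));
        last by rewrite e rmorph0.
      rewrite rmorphD rmorphXn rmorph_sum; congr (_ + _).
      by apply: eq_bigr => i _; rewrite !rmorphM !rmorphXn.
    apply: tfrac_of_inj; rewrite rmorph0 -[RHS](mulr0 (tfrac_of q ^+ n)) -Px.
    rewrite big_ord_recr /= mulrDr addrC mulr_sumr rmorphD rmorph_sum.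
    congr (_ + _).
      apply: eq_bigr => i _; rewrite !rmorphM !rmorphXn /= -qx exprMn coef_map /=.
      have -> : tfrac_of q ^+ n = tfrac_of q ^+ i * tfrac_of q ^+ (n - i).
        by rewrite -exprD subnKC // ltnW.
      ring.
    rewrite coef_map /= -/(lead_coef P) (eqP Pmon) rmorph1 mul1r rmorphXn /= -qx.
    by rewrite exprMn.
  exists a; apply: (tfrac_of_mulI qP).
  by rewrite qx -phiR ia phiM phiR mulrC.
apply: (@delta_quotient_basis _ _ _ _ (phi \o b)); split=> [i|x /normP[a ->]].
  exact: phi_int.
have [y [[r ar] yU]] := b_basis a.
exists y; split; first by exists r; rewrite ar phi_comb.
by move=> y' [r' ar']; apply: yU; exists r'; apply: phi_inj; rewrite phi_comb.
Qed.
End Overring.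

(** * Power series *)

(* Coefficients of products are to be computed by lemmas, not by unfolding. *)
Local Arguments fps_coef {R} f k : simpl never.

Section PowerSeries.
Variable R : comNzRingType.
Implicit Types f g h : fps R.
Local Notation X := (fpsX R).

Lemma coef_FPS (u : nat -> R) k : fps_coef (FPS u) k = u k.
Proof. by []. Qed.

Lemma fps_eq f g : (forall k, fps_coef f k = fps_coef g k) -> f = g.
Proof. by move/fpsP. Qed.

Lemma fps_coef0 k : fps_coef (0 : fps R) k = 0.
Proof. by case: k. Qed.
Lemma fps_coef1 k : fps_coef (1 : fps R) k = (k == 0%N)%:R.
Proof. by case: k. Qed.
Lemma fps_coefD f g k : fps_coef (f + g) k = fps_coef f k + fps_coef g k.
Proof. by []. Qed.
Lemma fps_coefB f g k : fps_coef (f - g) k = fps_coef f k - fps_coef g k.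
Proof. by []. Qed.
Lemma fps_coefM f g k :
  fps_coef (f * g) k = \sum_(i < k.+1) fps_coef f i * fps_coef g (k - i).
Proof. by []. Qed.
Lemma fps_coef_sum I (r : seq I) (P : pred I) (G : I -> fps R) k :
  fps_coef (\sum_(i <- r | P i) G i) k = \sum_(i <- r | P i) fps_coef (G i) k.
Proof. by elim/big_rec2: _ => [|i x y _ <-]; rewrite ?fps_coef0. Qed.

Lemma fps_coefCM a f k : fps_coef (fpsC a * f) k = a * fps_coef f k.
Proof.
rewrite fps_coefM big_ord_recl /= subn0 big1 ?addr0 // => i _.
by rewrite mul0r.
Qed.

Lemma fps_coef0M f g : fps_coef (f * g) 0 = fps_coef f 0 * fps_coef g 0.
Proof. by rewrite fps_coefM big_ord1. Qed.

Lemma fps_coefXM f k :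
  fps_coef (X * f) k = if k is k'.+1 then fps_coef f k' else 0.
Proof.
case: k => [|k]; first by rewrite fps_coef0M mul0r.
rewrite fps_coefM 2!big_ord_recl /= mul0r mul1r add0r subSS subn0.
by rewrite big1 ?addr0 // => i _; rewrite mul0r.
Qed.

Lemma fps_coefXnM n f k :
  fps_coef (X ^+ n * f) k = if (k < n)%N then 0 else fps_coef f (k - n).
Proof.
elim: n k => [|n IH] k; first by rewrite expr0 mul1r subn0.
by rewrite exprS -mulrA fps_coefXM; case: k => [|k] //; rewrite IH subSS ltnS.
Qed.

(** Division by [X^n], dropping the lower coefficients. *)
Definition fps_shift n f := FPS (fun k => fps_coef f (k + n)).

Lemma fps_shiftP n f : (forall k, (k < n)%N -> fps_coef f k = 0) ->
  f = X ^+ n * fps_shift n f.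
Proof.
move=> f0; apply: fps_eq => k; rewrite fps_coefXnM; case: ltnP => kn.
  exact: f0.
by rewrite coef_FPS subnK.
Qed.

Lemma fps_split f : f = fpsC (fps_coef f 0) + X * fps_shift 1 f.
Proof.
apply: fps_eq => k; rewrite fps_coefD fps_coefXM.
by case: k => [|k] /=; rewrite ?coef_FPS ?addr0 ?add0r ?addn1.
Qed.

Lemma fpsX_lreg n : GRing.lreg (X ^+ n).
Proof.
move=> f g fg; apply: fps_eq => k.
have := congr1 (fun h => fps_coef h (k + n)) fg.
by rewrite !fps_coefXnM ltnNge leq_addl /= addnK.
Qed.
End PowerSeries.

Section Substitution.
Variables (R : comNzRingType) (w : fps R).
Hypothesis w0 : fps_coef w 0 = 0.
Implicit Types (f g : fps (fps R)) (a : fps R).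
Local Notation Y := (fpsX (fps R)).

Lemma fps_coefMw a j k : (k < j)%N -> fps_coef (a * w ^+ j) k = 0.
Proof.
move=> kj; have -> : w = fpsX R ^+ 1 * fps_shift 1 w.
  by apply: fps_shiftP => -[].
by rewrite exprMn -exprM mul1n mulrCA fps_coefXnM kj.
Qed.

(** The value of a power series in [Y] at [Y = w].  As [w] has no constant term,
    [w^j] contributes only to coefficients of index at least [j]. *)
Definition fps_subst f : fps R :=
  FPS (fun k => \sum_(j < k.+1) fps_coef (fps_coef f j * w ^+ j) k).

Lemma coef_subst f k N : (k < N)%N ->
  fps_coef (fps_subst f) k = \sum_(j < N) fps_coef (fps_coef f j * w ^+ j) k.
Proof.
move=> kN; rewrite coef_FPS.
rewrite (big_ord_widen N (fun j => fps_coef (fps_coef f j * w ^+ j) k)) //.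
rewrite big_mkcond; apply: eq_bigr => j _; case: ltnP => // kj.
by rewrite fps_coefMw.
Qed.

Lemma substD f g : fps_subst (f + g) = fps_subst f + fps_subst g.
Proof.
apply: fps_eq => k; rewrite fps_coefD !coef_FPS -big_split.
by apply: eq_bigr => j _; rewrite mulrDl.
Qed.

Lemma substC a : fps_subst (fpsC a) = a.
Proof.
apply: fps_eq => k; rewrite coef_FPS big_ord_recl mulr1 big1 ?addr0 // => j _.
by rewrite mul0r fps_coef0.
Qed.

Let subst_sum a f k : fps_coef (a * fps_subst f) k =
  \sum_(j < k.+1) fps_coef (a * (fps_coef f j * w ^+ j)) k.
Proof.
rewrite fps_coefM; under eq_bigr => i _.
  rewrite (@coef_subst _ _ k.+1) ?ltnS ?leq_subr // mulr_sumr; over.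
rewrite exchange_big; apply: eq_bigr => j _; by rewrite fps_coefM.
Qed.

Lemma substCM a f : fps_subst (fpsC a * f) = a * fps_subst f.
Proof.
apply: fps_eq => k; rewrite subst_sum coef_FPS.
by apply: eq_bigr => j _; rewrite fps_coefCM mulrA.
Qed.

Lemma substXM f : fps_subst (Y * f) = w * fps_subst f.
Proof.
apply: fps_eq => k; rewrite subst_sum coef_FPS big_ord_recl big_ord_recr /=.
rewrite fps_coefXM mul0r fps_coef0 add0r mulrCA -exprS fps_coefMw // addr0.
by apply: eq_bigr => j _; rewrite fps_coefXM mulrCA -exprS.
Qed.

(** Division by [Y - w], by Horner's scheme: the [j]-th coefficient of the
    quotient is the value at [w] of [f] shifted [j + 1] times. *)
Lemma subst_div f : exists h, f = (Y - fpsC w) * h + fpsC (fps_subst f).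
Proof.
exists (FPS (fun j => fps_subst (fps_shift j.+1 f))).
have step j : fps_subst (fps_shift j f) =
    fps_coef f j + w * fps_subst (fps_shift j.+1 f).
  rewrite {1}[fps_shift j f]fps_split substD substC substXM; congr (_ + _ * fps_subst _).
  by apply: fps_eq => k; rewrite !coef_FPS -addnA add1n.
apply: fps_eq => -[|k]; rewrite fps_coefD mulrBl fps_coefB;
  rewrite fps_coefXM fps_coefCM !coef_FPS /=.
  rewrite (_ : fps_subst f = fps_subst (fps_shift 0 f)).
    by rewrite (step 0); ring.
  by congr (fps_subst _); apply: fps_eq => k; rewrite coef_FPS addn0.
by rewrite (step k.+1); ring.
Qed.

Lemma subst_factor h : fps_subst ((Y - fpsC w) * h) = 0.
Proof. by rewrite mulrBl -mulNr -rmorphN substD substXM substCM; ring. Qed.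

(** Multiplicativity follows from division: modulo the multiples of [Y - w],
    which vanish at [w], a series is the constant given by its value. *)
Lemma substM f g : fps_subst (f * g) = fps_subst f * fps_subst g.
Proof.
have [f' {1}->] := subst_div f; rewrite mulrDl -mulrA substD subst_factor add0r.
by rewrite substCM.
Qed.

End Substitution.

Section PowerSeriesField.
Variable K : fieldType.
Implicit Types f g : fps K.
Local Notation X := (fpsX K).

(** With [f = f_0 (1 - w)], substitute [w] into [(1 - Y) (1 + Y + ...) = 1]. *)
Lemma fps_unit f : fps_coef f 0 != 0 -> exists g, f * g = 1.
Proof.
move=> f0; set a := fps_coef f 0 in f0; pose w := 1 - fpsC a^-1 * f.
have w0 : fps_coef w 0 = 0.
  by rewrite fps_coefB fps_coefCM fps_coef1 mulVf // subrr.
have geom : (1 - fpsX (fps K)) * FPS (fun => 1) = 1.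
  apply: fps_eq => k; rewrite mulrBl mul1r fps_coefB fps_coefXM fps_coef1.
  by case: k => [|k] /=; rewrite ?coef_FPS ?subr0 ?subrr.
have := congr1 (fps_subst w) geom; rewrite (substM w0).
have -> : 1 - fpsX (fps K) = fpsC 1 + fpsX (fps K) * fpsC (-1).
  by rewrite rmorphN rmorph1; ring.
rewrite -[in RHS](rmorph1 (@fpsC (fps K))) substD (substXM w0) !substC => wE.
exists (fpsC a^-1 * fps_subst w (FPS (fun => 1))).
have fw : fpsC a^-1 * f = 1 - w by rewrite /w; ring.
by rewrite mulrCA mulrA fw -[RHS]wE; ring.
Qed.

Lemma fps_factor f : f != 0 -> exists n g h, f = X ^+ n * g /\ g * h = 1.
Proof.
move=> f0; have [k fk] : exists k, fps_coef f k != 0.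
  apply: contra_neqP f0 => nk; apply: fps_eq => k; rewrite fps_coef0.
  by apply/eqP/negPn/negP => fk; apply: nk; exists k.
have [n fn nmin] := ex_minnP (ex_intro (fun k => fps_coef f k != 0) k fk).
have [h gh] : exists h, fps_shift n f * h = 1 by apply: fps_unit.
exists n, (fps_shift n f), h; split=> //; apply: fps_shiftP => i ilt.
by apply/eqP; apply: contraTT ilt => /nmin; rewrite -leqNgt.
Qed.

Lemma fps_lreg f : f != 0 -> GRing.lreg f.
Proof.
move=> /fps_factor[n [g [h [-> gh]]]]; apply: lregM; first exact: fpsX_lreg.
move=> x y /(congr1 ( *%R h)); by rewrite !mulrA ![h * g]mulrC gh !mul1r.
Qed.

(** If [Q] does not divide [P] then [Q = P Y] with [Y] without constant term.
    Dividing the monic equation by [P^n] gives [1 + (terms in Y) = 0], which is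
    absurd in degree [0]. *)
Lemma fps_integrally_closed : integrally_closed (fps K).
Proof.
move=> n C P Q Qreg.
have Q0 : Q != 0.
  apply/eqP => Q0; have := Qreg 1 0; rewrite Q0 !mul0r => /(_ erefl)/eqP.
  by rewrite oner_eq0.
have [->|P0] := eqVneq P 0; first by exists 0; rewrite mul0r.
have [k [g [h [PE gh]]]] := fps_factor P0.
have [l [g' [h' [QE gh']]]] := fps_factor Q0.
have [lk _|kl] := leqP l k.
  exists (X ^+ (k - l) * g * h').
  transitivity (X ^+ l * X ^+ (k - l) * g * (g' * h')); last by rewrite QE; ring.
  by rewrite gh' mulr1 -exprD subnKC.
have QY : Q = P * (X ^+ (l - k) * g' * h).
  transitivity (X ^+ k * X ^+ (l - k) * g' * (g * h)); last by rewrite PE; ring.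
  by rewrite gh mulr1 -exprD subnKC // ltnW.
set Y := _ * h in QY.
have Y0 : fps_coef Y 0 = 0.
  by rewrite !fps_coef0M -[X ^+ _]mulr1 fps_coefXnM subn_gt0 kl !mul0r.
have -> : P ^+ n + \sum_(i < n) C i * P ^+ i * Q ^+ (n - i) =
    P ^+ n * (1 + \sum_(i < n) C i * Y ^+ (n - i)).
  rewrite mulrDr mulr1 mulr_sumr; congr (_ + _); apply: eq_bigr => i _.
  rewrite QY exprMn.
  have -> : P ^+ n = P ^+ i * P ^+ (n - i) by rewrite -exprD subnKC // ltnW.
  ring.
have Pn : GRing.lreg (P ^+ n) by apply/lregX/fps_lreg.
rewrite -[RHS](mulr0 (P ^+ n)) => /Pn /(congr1 (fun f => fps_coef f 0)).
rewrite fps_coefD fps_coef_sum big1 => [|i _].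
  by rewrite fps_coef1 fps_coef0 addr0 => /eqP; rewrite oner_eq0.
have [j ->] : exists j, (n - i = j.+1)%N by exists (n - i).-1; have := ltn_ord i; lia.
by rewrite exprS fps_coef0M (fps_coef0M Y) Y0 mul0r mulr0.
Qed.

End PowerSeriesField.

(** * The dimension of normalization modulo ring *)

Section SubringInclusion.
Variables (A : comNzRingType) (S : subringClosed A).
Definition subring_val : {rmorphism subring_of S -> A} := val.
Lemma subring_val_inj : injective subring_val.
Proof. exact: val_inj. Qed.
End SubringInclusion.

Lemma coef_monomial_sum (R : comNzRingType) d (e : 'I_d -> nat) (x : 'I_d -> R) j :
  injective e ->
  fps_coef (\sum_(i < d) fpsC (x i) * fpsX R ^+ e i) (e j) = x j.
Proof.
move=> e_inj; rewrite fps_coef_sum (bigD1 j) //= big1 => [|i ij];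
  rewrite fps_coefCM -[_ ^+ _]mulr1 fps_coefXnM fps_coef1.
  by rewrite ltnn subnn mulr1 addr0.
case: ltngtP => [||/e_inj ji]; rewrite ?mulr0 //; last by rewrite ji eqxx in ij.
by move=> lt; rewrite subn_eq0 leqNgt lt mulr0.
Qed.

Section Cusp.
Variables (F : finFieldType) (m : nat).

Definition even_part (f : fps F) := FPS (fun k => if odd k then 0 else fps_coef f k).

Lemma cusp_even f : (forall k, odd k -> fps_coef f k = 0) -> f \in @in_cusp F m.
Proof. by move=> f0; apply/in_cuspP => k /f0. Qed.

(** The even series lie in the ring, so the odd part [o] of [f] satisfies
    [o^2] in [R]: this is the quadratic equation of [f].  The conductor
    contains [T^(2m)]. *)
Lemma delta_cusp : delta (scalar_cusp F m) = m.
Proof.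
pose iota : {rmorphism R_cusp F m -> fps F} := subring_val (@in_cusp F m).
have lift f : f \in @in_cusp F m -> exists r, iota r = f.
  by move=> fR; exists (exist _ f fR).
have [s sE] : exists s, iota s = fpsX F ^+ (2 * m).
  apply/lift/cusp_even => k ok; rewrite -[_ ^+ _]mulr1 fps_coefXnM fps_coef1.
  by case: ltnP => // mk; case: eqP => // k2; move: ok mk; lia.
apply: (@delta_overring _ _ _ _ iota s _ _ _ _ _ _
  (fun i : 'I_m => fpsX F ^+ (2 * i + 1))).
- exact: subring_val_inj.
- by rewrite sE; apply: fpsX_lreg.
- move=> f; rewrite sE; apply/lift/in_cuspP => k ok km; rewrite fps_coefXnM.
  by rewrite ifT //; lia.
- move=> f; set o := f - even_part f.
  have oE k : ~~ odd k -> fps_coef o k = 0.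
    by rewrite fps_coefB coef_FPS => /negPf ->; rewrite subrr.
  have [p pE] : exists p, iota p = even_part f.
    by apply/lift/cusp_even => k ok; rewrite coef_FPS ok.
  have [q qE] : exists q, iota q = o * o.
    apply/lift/cusp_even => k ok; rewrite fps_coefM big1 // => i _.
    case oi : (odd i); last by rewrite oE ?oi ?mul0r.
    by rewrite [X in _ * X]oE ?mulr0 // oddB ?ok ?oi // -ltnS.
  exists (p + p), (q - p * p).
  have -> : iota (p + p) = even_part f + even_part f by rewrite -pE rmorphD.
  have -> : iota (q - p * p) = o * o - even_part f * even_part f.
    by rewrite -pE -qE rmorphB rmorphM.
  by rewrite /o; ring.
- exact: fps_integrally_closed.
have e_inj : injective (fun i : 'I_m => (2 * i + 1)%N).
  by move=> i j ij; apply: val_inj => /=; lia.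
have coefE (x : {ffun 'I_m -> F}) r (j : 'I_m) :
    fps_coef (\sum_(i < m) iota (scalar_cusp F m (x i)) * fpsX F ^+ (2 * i + 1)
      + iota r) (2 * j + 1) = x j.
  have /in_cuspP rR : iota r \in @in_cusp F m := valP r.
  rewrite fps_coefD (coef_monomial_sum x j e_inj) rR ?addr0 //.
    by rewrite oddD mul2n odd_double.
  by have := ltn_ord j; lia.
move=> f; exists [ffun i : 'I_m => fps_coef f (2 * i + 1)]; split; last first.
  by move=> x [r ->]; apply/ffunP => j; rewrite ffunE coefE.
set x := finfun _.
have [r rE] : exists r, iota r =
    f - \sum_(i < m) iota (scalar_cusp F m (x i)) * fpsX F ^+ (2 * i + 1).
  apply/lift/in_cuspP => k ok km; rewrite fps_coefB.
  have k2 : (k./2 < m)%N by lia.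
  have -> : k = (2 * Ordinal k2 + 1)%N by rewrite /=; lia.
  by have := coefE x 0 (Ordinal k2); rewrite rmorph0 addr0 => ->; rewrite ffunE subrr.
by exists r; rewrite rE addrC subrK.
Qed.
End Cusp.

Lemma lreg_pair (A B : comNzRingType) (a : A) (b : B) :
  GRing.lreg (a, b) <-> GRing.lreg a /\ GRing.lreg b.
Proof.
split=> [ab|[ra rb] [x y] [x' y'] [/ra -> /rb ->] //]; split=> x y e.
  by have [] := ab (x, 0) (y, 0) (congr2 pair e erefl).
by have [] := ab (0, x) (0, y) (congr2 pair erefl e).
Qed.

Lemma integrally_closed_pair (A B : comNzRingType) :
  integrally_closed A -> integrally_closed B -> integrally_closed (A * B)%type.
Proof.
move=> Acl Bcl n C [P1 P2] [Q1 Q2] /lreg_pair[rQ1 rQ2] e.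
have powE (x : A * B) k : x ^+ k = (x.1 ^+ k, x.2 ^+ k).
  by elim: k => // k IH; rewrite !exprS IH.
have sumE (G : 'I_n -> A * B) :
    \sum_(i < n) G i = (\sum_(i < n) (G i).1, \sum_(i < n) (G i).2).
  by elim/big_rec3: _ => // i x y z _ ->.
have := e; rewrite sumE powE => -[e1 e2].
have [|a1 ->] := Acl n (fun i => (C i).1) P1 Q1 rQ1.
  by rewrite -[RHS]e1; congr (_ + _); apply: eq_bigr => i _; rewrite !powE.
have [|a2 ->] := Bcl n (fun i => (C i).2) P2 Q2 rQ2.
  by rewrite -[RHS]e2; congr (_ + _); apply: eq_bigr => i _; rewrite !powE.
by exists (a1, a2).
Qed.

Section Split.
Variables (F : finFieldType) (m : nat).
Hypothesis m_gt0 : (0 < m)%N.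
Let w : fps F := fpsX F ^+ m.

Let w0 : fps_coef w 0 = 0.
Proof. by rewrite -[w]mulr1 fps_coefXnM m_gt0. Qed.

(** The two branches [Y = 0] and [Y = X^m]. *)
Definition split_eval (f : fps (fps F)) : fps F * fps F :=
  (fps_coef f 0, fps_subst w f).

Lemma split_evalD f g : split_eval (f + g) = split_eval f + split_eval g.
Proof. by rewrite /split_eval substD. Qed.

Lemma split_evalM f g : split_eval (f * g) = split_eval f * split_eval g.
Proof. by rewrite /split_eval (substM w0) fps_coef0M. Qed.

Lemma split_evalC a : split_eval (fpsC a) = (a, a).
Proof. by rewrite /split_eval substC. Qed.

Lemma split_eval_line a b : split_eval (fpsC a + fpsX _ * fpsC b) = (a, a + w * b).
Proof.
by rewrite /split_eval substD (substXM w0) !substC fps_coefD fps_coefXM addr0.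
Qed.

(** Vanishing on [Y = 0] gives a factor [Y], and then vanishing on [Y = X^m]
    gives a factor [Y - X^m], since [X^m] is not a zero divisor. *)
Lemma split_eval_ker f : split_eval f = 0 <-> f \in @in_split_ideal F m.
Proof.
have wY : varX F ^+ m = fpsC w by rewrite /varX -rmorphXn.
split=> [fe|/asboolP[g ->]]; last first.
  rewrite split_evalM (_ : split_eval (_ * (_ - _)) = 0) ?mulr0 // wY /split_eval.
  by rewrite fps_coefXM mulrC (subst_factor w0).
have f0 : fps_coef f 0 = 0 := congr1 fst fe.
have fw : fps_subst w f = 0 := congr1 snd fe.
have := fps_split f; rewrite f0 rmorph0 add0r; set g := fps_shift 1 f => fE.
have gw : fps_subst w g = 0.
  by apply: (@fpsX_lreg _ m); rewrite mulr0 -/w -substXM // -fE.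
apply/asboolP; have [h gE] := subst_div w0 g; exists h.
by rewrite fE gE gw rmorph0 wY /varY; ring.
Qed.

Definition split_embedding (x : R_split F m) : fps F * fps F :=
  split_eval (repr x).

Lemma split_embedding_pi f :
  split_embedding (\pi_(R_split F m)%qT f) = split_eval f.
Proof.
apply/eqP; rewrite -subr_eq0; apply/eqP.
have -> : - split_eval f = split_eval (- f).
  apply/esym/eqP; rewrite -addr_eq0 -split_evalD addNr.
  by rewrite (_ : 0 = fpsC 0) ?split_evalC // rmorph0.
rewrite -split_evalD; apply/split_eval_ker.
have := Quotient.idealrBE (@in_split_ideal F m) (repr (\pi_(R_split F m)%qT f)) f.
by rewrite [X in _ = X](_ : _ = true) //; apply/eqP/reprK.
Qed.

(** The image of the ring consists of the pairs that are congruent modulo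
    [X^m].  A pair [(f, g)] is a root of [(x - f) (x - g)], whose coefficients
    are diagonal. *)
Lemma delta_split : delta (scalar_split F m) = m.
Proof.
pose pi (f : fps (fps F)) : R_split F m := (\pi_(R_split F m)%qT f).
have piK f : split_embedding (pi f) = split_eval f by apply: split_embedding_pi.
have reprP x : x = pi (repr x) by rewrite /pi reprK.
have iz : zmod_morphism (@split_embedding : R_split F m -> _).
  move=> x y; rewrite (reprP x) (reprP y) -rmorphB !piK.
  apply/esym/eqP; rewrite subr_eq -split_evalD subrK //.
have im : monoid_morphism (@split_embedding : R_split F m -> _).
  split=> [|x y]; last by rewrite (reprP x) (reprP y) -rmorphM !piK split_evalM.
  by rewrite (_ : 1 = pi (fpsC 1)) ?piK ?split_evalC // /pi !rmorph1.
pose iota : {rmorphism R_split F m -> (fps F * fps F)%type} :=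
  HB.pack split_embedding (GRing.isZmodMorphism.Build _ _ _ iz)
   (GRing.isMonoidMorphism.Build _ _ _ im).
have iotaE f : iota (pi f) = split_eval f by apply: piK.
have iota_scalar a : iota (scalar_split F m a) = (fpsC a, fpsC a).
  by rewrite -[scalar_split F m a]/(pi (fpsC (fpsC a))) iotaE split_evalC.
apply: (@delta_overring _ _ _ _ iota (pi (fpsC w)) _ _ _ _ _ _
  (fun i : 'I_m => (0, fpsX F ^+ i))).
- move=> x y; rewrite (reprP x) (reprP y) => /eqP.
  rewrite -subr_eq0 -rmorphB -rmorphB iotaE => /eqP /split_eval_ker xy.
  by apply/eqP; rewrite -[_ == _]Quotient.idealrBE.
- by rewrite iotaE split_evalC; apply/lreg_pair; split; apply: fpsX_lreg.
- move=> [a b]; exists (pi (fpsC (w * a) + fpsX _ * fpsC (b - a))).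
  rewrite !iotaE split_eval_line split_evalC -[RHS]/(w * a, w * b).
  by congr pair; ring.
- move=> [a b]; exists (pi (fpsC (a + b))), (pi (fpsC (- (a * b)))).
  by rewrite !iotaE !split_evalC; congr pair => /=; ring.
- exact: integrally_closed_pair (@fps_integrally_closed F) (@fps_integrally_closed F).
pose comb (x : {ffun 'I_m -> F}) := \sum_(i < m) fpsC (x i) * fpsX F ^+ i.
have combE (x : {ffun 'I_m -> F}) :
    \sum_(i < m) iota (scalar_split F m (x i)) * (0, fpsX F ^+ i) = (0, comb x).
  rewrite /comb; elim/big_rec2: _ => // i y _ _ ->.
  by rewrite iota_scalar; congr pair => /=; ring.
move=> [f g]; pose x := [ffun i : 'I_m => fps_coef (g - f) i].
have comb_coef (y : {ffun 'I_m -> F}) (j : 'I_m) : fps_coef (comb y) j = y j.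
  exact: (coef_monomial_sum y j val_inj).
exists x; split.
  have hE : g - f - comb x = w * fps_shift m (g - f - comb x).
    apply: fps_shiftP => k km; rewrite fps_coefB.
    by rewrite -[k]/(val (Ordinal km)) comb_coef ffunE subrr.
  exists (pi (fpsC f + fpsX _ * fpsC (fps_shift m (g - f - comb x)))).
  rewrite combE iotaE split_eval_line -hE; congr pair => /=; ring.
move=> y [r]; rewrite combE (reprP r) iotaE.
move=> e; have fE := congr1 fst e; have gE := congr1 snd e; rewrite /= in fE gE.
apply/ffunP => j; rewrite ffunE fE gE.
rewrite {1}[repr r]fps_split substD substC (substXM w0) add0r.
rewrite (_ : _ - _ = comb y + w * fps_subst w (fps_shift 1 (repr r))); last by ring.
by rewrite fps_coefD comb_coef fps_coefXnM ltn_ord addr0.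
Qed.
End Split.

(** [1] and any [theta] outside [F] form a basis of [K]; the second clause says
    that they are independent. *)
Lemma quadratic_generator (F : fieldType) (K : fieldExtType F) :
  \dim {:K} = 2%N -> exists theta : K,
  (forall y, exists a b : F, y = a%:A + b *: theta) /\
  (forall a b : F, b *: theta = a%:A -> b = 0).
Proof.
move=> dimK; have [theta theta1] : exists theta : K, theta \notin 1%VS.
  apply/not_existsP => all1.
  suff /dimvS : ({:K} <= 1)%VS by rewrite dimv1 dimK.
  by apply/subvP => y _; apply/negPn/negP/all1.
have indep a b : b *: theta = a%:A -> b = 0.
  move=> bt; apply/eqP; apply: contraNT theta1 => b0.
  apply/vlineP; exists (b^-1 * a).
  by rewrite -scalerA -bt scalerA mulVf // scale1r.
exists theta; split=> // y.
have span : (1%VS + <[theta]> = {:K})%VS.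
  apply/eqP; rewrite eqEdim subvf dimK dimv_disjoint_sum; last first.
    apply/eqP; rewrite -subv0; apply/subvP => x /memv_capP[/vlineP[a ->] /vlineP[b ab]].
    by rewrite ab (indep a b) ?scale0r ?mem0v.
  rewrite dimv1 dim_vline; case: eqP => // t0.
  by move: theta1; rewrite t0 mem0v.
have : y \in (1%VS + <[theta]>)%VS by rewrite span memvf.
by move=> /memv_addP[_ /vlineP[a ->] [_ /vlineP[b ->] ->]]; exists a, b.
Qed.

Section Inert.
Variables (F : finFieldType) (K : fieldExtType F) (m : nat).

Lemma in_inertP (f : fps K) :
  reflect (forall k, (k < m)%N -> exists y : F, fps_coef f k = y%:A)
    (f \in @in_inert F K m).
Proof.
apply: (iffP (asboolP _)) => [[a [b ->]] k km|fF].
  by exists (fps_coef a k); rewrite fps_coefD fps_coefXnM km addr0.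
have /boolp.choice[u uP] : forall k, exists y : F, (k < m)%N -> fps_coef f k = y%:A.
  move=> k; case: ltnP => [/fF[y yP]|_]; last by exists 0.
  by exists y.
exists (FPS u), (fps_shift m (f - fps_map (in_alg K) (FPS u))).
rewrite -fps_shiftP; first by rewrite addrC subrK.
by move=> k km; rewrite fps_coefB uP // subrr.
Qed.

Hypothesis dimK : \dim {:K} = 2%N.

(** [K[[T]] = F[[T]] + theta F[[T]]], and the quadratic equation of [theta] over
    [F] gives one over [F[[T]]] for each element. *)
Lemma delta_inert : delta (scalar_inert K m) = m.
Proof.
have [theta [span indep]] := quadratic_generator dimK.
pose iota : {rmorphism R_inert K m -> fps K} := subring_val (@in_inert F K m).
pose emb : {rmorphism fps F -> fps K} := fps_map (in_alg K).
have lift f : f \in @in_inert F K m -> exists r, iota r = f.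
  by move=> fR; exists (exist _ f fR).
have lift_emb g : exists r, iota r = emb g.
  by apply/lift/in_inertP => k _; exists (fps_coef g k).
have split_theta f : exists g h, f = emb g + fpsC theta * emb h.
  have /boolp.choice[u uP] : forall k, exists ab : F * F,
      fps_coef f k = ab.1%:A + ab.2 *: theta.
    by move=> k; have [a [b ->]] := span (fps_coef f k); exists (a, b).
  exists (FPS (fun k => (u k).1)), (FPS (fun k => (u k).2)).
  apply: fps_eq => k; rewrite fps_coefD fps_coefCM uP; congr (_ + _).
  by rewrite mulr_algr.
have [s sE] : exists s, iota s = fpsX K ^+ m.
  apply/lift/in_inertP => k km; exists 0.
  by rewrite -[_ ^+ _]mulr1 fps_coefXnM km scale0r.
have [a [b theta2]] := span (theta * theta).
have Ctheta2 : fpsC theta * fpsC theta = emb (fpsC a) + fpsC theta * emb (fpsC b).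
  rewrite -rmorphM theta2 rmorphD; congr (_ + _).
    by apply: fps_eq => -[|k]; [|exact/esym/scale0r].
  apply: fps_eq => k; rewrite fps_coefCM.
  case: k => [|k]; first exact/esym/mulr_algr.
  have -> : fps_coef (emb (fpsC b)) k.+1 = 0 by exact: (scale0r 1).
  by rewrite mulr0.
apply: (@delta_overring _ _ _ _ iota s _ _ _ _ _ _
  (fun i : 'I_m => fpsC theta * fpsX K ^+ i)).
- exact: subring_val_inj.
- by rewrite sE; apply: fpsX_lreg.
- move=> f; rewrite sE; apply/lift/in_inertP => k km; exists 0.
  by rewrite fps_coefXnM km scale0r.
- move=> f; have [g [h ->]] := split_theta f.
  have [p pE] := lift_emb (g + g + h * fpsC b).
  have [q qE] := lift_emb (h * h * fpsC a - g * g - h * fpsC b * g).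
  exists p, q; rewrite pE qE.
  rewrite !(rmorphB emb) !(rmorphD emb) !(rmorphM emb).
  transitivity (emb g * emb g + 2 * emb g * (fpsC theta * emb h) +
    (fpsC theta * fpsC theta) * (emb h * emb h)); first by ring.
  by rewrite Ctheta2; ring.
- exact: fps_integrally_closed.
pose comb (x : {ffun 'I_m -> F}) :=
  \sum_(i < m) iota (scalar_inert K m (x i)) * (fpsC theta * fpsX K ^+ i).
have combE x (j : 'I_m) : fps_coef (comb x) j = x j *: theta.
  have -> : comb x = \sum_(i < m) fpsC ((x i)%:A * theta) * fpsX K ^+ val i.
    by apply: eq_bigr => i _; rewrite rmorphM mulrA.
  by rewrite (coef_monomial_sum _ j val_inj) mulr_algl.
move=> f; have [g [h fE]] := split_theta f.
have f_coef k : fps_coef f k = (fps_coef g k)%:A + fps_coef h k *: theta.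
  by rewrite fE fps_coefD fps_coefCM mulr_algr.
exists [ffun i : 'I_m => fps_coef h i]; split.
  set x := finfun _.
  have [r rE] : exists r, iota r = f - comb x.
    apply/lift/in_inertP => k km; exists (fps_coef g k).
    by rewrite fps_coefB f_coef (combE x (Ordinal km)) ffunE addrK.
  by exists r; rewrite rE addrC subrK.
move=> y [r rE]; apply/ffunP => j; rewrite ffunE.
have /in_inertP/(_ _ (ltn_ord j))[d rj] : iota r \in @in_inert F K m := valP r.
apply/eqP; rewrite -subr_eq0; apply/eqP/(indep (d - fps_coef g j)).
have := f_coef j; rewrite rE fps_coefD -/(comb y) combE rj.
rewrite !scalerBl => e.
have -> : fps_coef h j *: theta = (y j *: theta + d%:A) - (fps_coef g j)%:A.
  by rewrite e addrC addKr.
ring.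
Qed.
End Inert.

(** * The functional equations for indeterminates and for the three rings *)

Theorem theorem6p7 (m n : nat) (hm : (1 <= m)%N) (hn : (1 <= n)%N) :
  (let u := indet (inord 0 : 'I_3) in
   let t := indet (inord 1 : 'I_3) in
   let z := indet (inord 2 : 'I_3) in
   master m n u t z =
     u ^+ (m * n) * z ^- (m * n ^ 2)
     * master m n (u^-1 * z ^+ (2 * n)) (u^-1 * t * z ^+ n) z)
  /\
  (forall (q p e : nat), prime p -> (0 < e)%N -> q = (p ^ e)%N ->
   forall F : finFieldType, #|F| = q ->
   let u := indet (inord 0 : 'I_2) in
   let t := indet (inord 1 : 'I_2) in
   let functional_equation (r : ring_family) (d : nat) :=
     Z_R r m n u t q =
       u ^+ (d * n) * q%:R ^+ (d * n ^ 2)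
       * Z_R r m n (u^-1 * q%:R ^- (2 * n)) (u^-1 * t * q%:R ^- n) q in
   [/\ functional_equation CuspR (delta (scalar_cusp F m)),
       functional_equation SplitR (delta (scalar_split F m)) &
       forall K : fieldExtType F, \dim {:K} = 2%N ->
         functional_equation InertR (delta (scalar_inert K m))]).
Proof.
split; first exact: master_indet_functional_equation.
move=> q p e p_prime e_gt0 qE F _ u t functional_equation.
have q_gt1 : (1 < q)%N by rewrite qE -(exp1n e) ltn_exp2r ?prime_gt1.
split=> [||K dimK].
- by rewrite delta_cusp; apply: Z_R_functional_equation.
- by rewrite delta_split //; apply: Z_R_functional_equation.
- by rewrite delta_inert //; apply: Z_R_functional_equation.
Qed.
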